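(* Let $\Bbbk$ be an algebraically closed field of arbitrary characteristic and suppose that $d\ge 3$ and $n\ge d+4$. Then $Y_{d,n}\subseteq V_{d,n}$ if and only if $(d,n)\in\{(3,7),(3,8),(4,8)\}$.
   Context: A rational normal curve in $\mathbb{P}^d$ is the image of the $d$-th Veronese embedding $\mathbb{P}^1\hookrightarrow\mathbb{P}^d$ up to projective automorphism. Let $U_{d,n}\subseteq(\mathbb{P}^d)^n$ be the locus of configurations $(p_1,\dots,p_n)$ of $n$ distinct points such that some rational normal curve in $\mathbb{P}^d$ contains all the $p_i$. $V_{d,n}\subseteq(\mathbb{P}^d)^n$ (the Veronese compactification) is the Zariski closure of $U_{d,n}$ with the reduced induced scheme structure. $Y_{d,n}\subseteq(\mathbb{P}^d)^n$ (the space of degenerate point configurations, i.e. those lying on a hyperplane) is the determinantal variety defined by all $(d+1)\times(d+1)$ minors of the $(d+1)\times n$ matrix whose columns are the homogeneous coordinates of the $n$ factors. *)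

(* Defs.v *)
From HB Require Import structures.
From mathcomp Require Import all_boot all_order all_algebra.
From mathcomp Require Import generic_quotient mpoly.

Set Implicit Arguments.
Unset Strict Implicit.
Unset Printing Implicit Defensive.

Import GRing.Theory.
Local Open Scope ring_scope.
Local Open Scope quotient_scope.

Section ProjectiveSpace.
Variables (k : fieldType) (d : nat).

Definition nzvec : Type := {v : 'rV[k]_d.+1 | v != 0}.
HB.instance Definition _ := Choice.on nzvec.

(* Two nonzero vectors span the same line; see same_lineP. *)
Definition same_line (v w : nzvec) : bool := (val v == val w)%MS.

Lemma same_line_refl : reflexive same_line.
Proof. by move=> v; rewrite /same_line submx_refl. Qed.

Lemma same_line_sym : ssrbool.symmetric same_line.
Proof. by move=> v w; rewrite /same_line andbC. Qed.

Lemma same_line_trans : transitive same_line.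
Proof.
move=> w v u /andP[vw wv] /andP[wu uw].
by rewrite /same_line (submx_trans vw wu) (submx_trans uw wv).
Qed.

Lemma same_lineP (v w : nzvec) :
  reflect (exists2 c : k, c != 0 & val w = c *: val v) (same_line v w).
Proof.
rewrite /same_line; apply: (iffP andP) => [[_ /sub_rVP[c wE]]|[c c0 wE]]; last first.
  by rewrite !wE !(eqmx_scale _ c0) !submx_refl.
exists c => //; apply: contraNneq (valP w) => c0.
by rewrite wE c0 scale0r.
Qed.

Canonical same_line_equiv :=
  EquivRel same_line same_line_refl same_line_sym same_line_trans.

Definition proj : Type := {eq_quot same_line}.
HB.instance Definition _ := Choice.on proj.
HB.instance Definition _ := EqQuotient.on proj.

Definition proj_class (v : nzvec) : proj := \pi_proj v.

(* A chosen vector of homogeneous coordinates. *)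
Definition hcoord (x : proj) : 'rV[k]_d.+1 := val (repr x).

Lemma hcoord_neq0 (x : proj) : hcoord x != 0.
Proof. exact: valP (repr x). Qed.

Lemma proj_classP (v w : nzvec) :
  proj_class v = proj_class w <-> exists2 c : k, c != 0 & val w = c *: val v.
Proof.
split=> [/eqmodP/same_lineP //|vw].
by apply/eqmodP/same_lineP.
Qed.

Lemma hcoord_class (v : nzvec) :
  exists2 c : k, c != 0 & hcoord (proj_class v) = c *: val v.
Proof. by apply/proj_classP; rewrite /proj_class reprK. Qed.

Lemma projaut_subproof (g : 'M[k]_d.+1) (x : proj) :
  g \in unitmx -> hcoord x *m g != 0.
Proof.
move=> gU; apply: contraNneq (hcoord_neq0 x) => xg0.
by rewrite -[hcoord x](mulmxK gU) xg0 mul0mx.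
Qed.

Definition projaut (g : 'M[k]_d.+1) (gU : g \in unitmx) (x : proj) : proj :=
  proj_class (exist _ (hcoord x *m g) (projaut_subproof x gU)).

Lemma projaut_class (g : 'M[k]_d.+1) (gU : g \in unitmx) (v w : nzvec) :
  val w = val v *m g -> projaut gU (proj_class v) = proj_class w.
Proof.
move=> wE; have [c c0 cE] := hcoord_class v.
apply/esym/proj_classP; exists c => //=.
by rewrite cE wE -scalemxAl.
Qed.

End ProjectiveSpace.

Section RationalNormalCurve.
Variables (k : fieldType) (d : nat).

(* [s : t] |-> [s ^ d : s ^ (d - 1) t : ... : t ^ d] *)
Definition veronese_vec (v : 'rV[k]_2) : 'rV[k]_d.+1 :=
  \row_(j < d.+1) (v 0 ord0 ^+ (d - j) * v 0 ord_max ^+ j).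

Lemma veronese_vec_neq0 (v : 'rV[k]_2) : v != 0 -> veronese_vec v != 0.
Proof.
apply: contra_neq => /rowP vv0.
have := vv0 ord0; rewrite !mxE subn0 expr0 mulr1 => /eqP.
rewrite expf_eq0 => /andP[_ /eqP s0].
have := vv0 ord_max; rewrite !mxE subnn expr0 mul1r => /eqP.
rewrite expf_eq0 => /andP[_ /eqP t0].
apply/rowP => j; rewrite mxE.
by case: j => [[|[|//]] lt_j]; [rewrite -[RHS]s0 | rewrite -[RHS]t0];
  congr (v 0 _); apply: val_inj.
Qed.

Definition veronese (x : proj k 1) : proj k d :=
  proj_class (exist _ (veronese_vec (hcoord x))
                      (veronese_vec_neq0 (hcoord_neq0 x))).

Lemma veronese_vecZ (c : k) (v : 'rV[k]_2) :
  veronese_vec (c *: v) = c ^+ d *: veronese_vec v.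
Proof.
apply/rowP => j; rewrite !mxE !exprMn mulrACA -exprD subnK //.
by rewrite -ltnS.
Qed.

Lemma veronese_class (v : nzvec k 1) (w : nzvec k d) :
  val w = veronese_vec (val v) -> veronese (proj_class v) = proj_class w.
Proof.
move=> wE; have [c c0 cE] := hcoord_class v.
apply/esym/proj_classP; exists (c ^+ d); first by rewrite expf_neq0.
by rewrite /= cE wE veronese_vecZ.
Qed.

Definition rational_normal_curve (C : proj k d -> Prop) : Prop :=
  exists (g : 'M[k]_d.+1) (gU : g \in unitmx),
    forall x, C x <-> exists y : proj k 1, x = projaut gU (veronese y).

End RationalNormalCurve.

Section Configurations.
Variables (k : fieldType) (d n : nat).

Definition config : Type := {ffun 'I_n -> proj k d}.

(* The multihomogeneous coordinate ring of (P^d)^n: the variable with index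
   mxvec_index i j is the j-th homogeneous coordinate on the i-th factor. *)
Definition coord_ring : Type := {mpoly k[n * d.+1]}.

Definition multihomog (f : coord_ring) : Prop :=
  exists e : 'I_n -> nat, forall m, m \in msupp f ->
    forall i, (\sum_(j < d.+1) m (mxvec_index i j))%N = e i.

Definition eval_rows (f : coord_ring) (M : 'M[k]_(n, d.+1)) : k :=
  f.@[mxvec M 0].

Definition vanishes_at (f : coord_ring) (p : config) : Prop :=
  eval_rows f (\matrix_(i < n) hcoord (p i)) = 0.

(* For multihomogeneous f, vanishing does not depend on the representatives. *)
Lemma eval_rowsZ (f : coord_ring) : multihomog f ->
  forall (c : 'I_n -> k) (M : 'M[k]_(n, d.+1)), (forall i, c i != 0) ->
  eval_rows f (\matrix_(i < n) (c i *: row i M)) = 0 <-> eval_rows f M = 0.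
Proof.
move=> [e he] c M c0.
suff -> : eval_rows f (\matrix_(i < n) (c i *: row i M))
    = (\prod_i c i ^+ e i) * eval_rows f M.
  split=> [/eqP|->]; last by rewrite mulr0.
  rewrite mulf_eq0 => /orP[/prodf_eq0[i _]|/eqP //].
  by rewrite expf_eq0 (negPf (c0 i)) andbF.
rewrite /eval_rows !mevalE mulr_sumr big_seq [RHS]big_seq.
apply: eq_bigr => m mf; rewrite mulrCA; congr (_ * _).
have prodE (F : 'I_(n * d.+1) -> k) :
    \prod_l F l = \prod_i \prod_(j < d.+1) F (mxvec_index i j).
  rewrite pair_bigA /= (reindex (uncurry (@mxvec_index n d.+1))) /=.
    by apply: eq_bigr => -[].
  exact: (curry_mxvec_bij n d.+1).
rewrite !prodE -big_split /=; apply: eq_bigr => i _.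
rewrite -(he m mf i) -prodrXr -big_split /=; apply: eq_bigr => j _.
by rewrite !mxvecE !mxE exprMn.
Qed.

Definition zariski_closed (Z : config -> Prop) : Prop :=
  exists2 S : coord_ring -> Prop, (forall f, S f -> multihomog f) &
    forall p, Z p <-> forall f, S f -> vanishes_at f p.

Definition zariski_closure (A : config -> Prop) (p : config) : Prop :=
  forall Z, zariski_closed Z -> (forall q, A q -> Z q) -> Z p.

Definition U_locus (p : config) : Prop :=
  injective p /\
  exists2 C : proj k d -> Prop, rational_normal_curve C & forall i, C (p i).

Definition V_locus : config -> Prop := zariski_closure U_locus.

Definition coord_mx (p : config) : 'M[k]_(d.+1, n) :=
  \matrix_(i < d.+1, j < n) hcoord (p j) 0 i.

(* A maximal minor is given by a strictly increasing choice of columns. *)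
Definition Y_locus (p : config) : Prop :=
  forall s : 'I_d.+1 -> 'I_n, {homo s : i j / (i < j)%N} ->
    \det (colsub s (coord_mx p)) = 0.

End Configurations.

Arguments U_locus k d n p : clear implicits.
Arguments V_locus k d n p : clear implicits.
Arguments Y_locus k d n p : clear implicits.

(* Main.v *)
From HB Require Import structures.
From mathcomp Require Import all_boot all_order all_algebra.
From mathcomp Require Import mpoly ring zify.
Require Import Defs.

(** Write the homogeneous coordinates of the [n] points as the rows of an
[n] x [d+1] matrix. Points on a rational normal curve give the matrices
[rnc_mx c s t G] with rows [c_i (s_i^d, s_i^(d-1) t_i, ..., t_i^d) G]. An
equation that holds for them when [G] is invertible and the points are distinct
holds for all [c, s, t, G] (vanish_rnc); with [G] of rank at most [d] these are
points on rational curves of degree [d] in a hyperplane. Points on a hyperplane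
give the products [N g] with [N] of size [n] x [d].

Outside the list, [Y] is too large. The action of PGL_2 on the parameters of the
curve fixes three of them, so that [U] becomes the image of a polynomial map in
[(d+1)^2 + 2n - 4] variables, whereas matrices of rank at most [d] have
[nd + d] algebraically independent entries. For [n >= d + 4] outside the list
the second number is at least the first one. Those entries together with one
maximal minor are therefore algebraically dependent on [U]
(algebraic_dependence). The minor vanishes on [Y] but not identically on [U], so
a power of it can be divided out of the relation, which then is an equation of
[U] that restricts to a nonzero polynomial in independent entries on [Y]
(Y_not_sub_V). Using the minor is what settles the cases of equality, as (3,9)
and (5,9), where [Y] and [V] have the same dimension.

In the list, a generic degenerate configuration lies on a rational curve of
degree [d] in its hyperplane, and the two proofs of this are different.

For [d = 3] and [n <= 8] the plane curve is a nodal cubic. The normal bundle of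
[t |-> (t, t^2, 1 + t^3)] has degree 7 in every characteristic, so [n <= 8] of
its points can be displaced to first order in any direction by moving the
points and the curve. A polynomial in the coordinates that vanishes on all such
configurations then has no term of lowest order at the chosen one
(mpoly_first_order, vanish_rank3).

For [(d, n) = (4, 8)] the first-order argument fails in characteristic 2, where
the normal bundle of a rational quartic in P^3 is unbalanced. Gale duality is
used instead. The columns of [N] span a 4-dimensional space of vectors in [k^8],
whose orthogonal space describes eight other points of P^3. The dual of a
generalized Reed-Solomon code is again one (grs_dual), so the points of [N] lie
on a rational quartic as soon as the dual points are projected into a conic from
some point, that is, as soon as they lie on a quadric cone (vanish_dual). The
quadrics through eight points form a pencil, and being singular is an equation
of degree 4 in the pencil, which has a solution over an algebraically closed
field (pencil_disc_root). *)
Set Implicit Arguments.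
Unset Strict Implicit.
Unset Printing Implicit Defensive.
Import GRing.Theory.
Local Open Scope ring_scope.


(** * Polynomials over an algebraically closed field *)

(** A root of [1 + 'X * p] is not a root of [p]. *)
Lemma poly_nonroot (k : closedFieldType) (p : {poly k}) :
  p != 0 -> exists x, p.[x] != 0.
Proof.
move=> p0; have : size (p * 'X + 1%:P) != 1%N.
  by rewrite size_MXaddC (negPf p0) /= eqSS size_poly_eq0.
move/closed_rootP => [x /eqP]; rewrite hornerMXaddC => px.
exists x; apply/eqP => px0; move/eqP: px.
by rewrite px0 mul0r add0r oner_eq0.
Qed.

Lemma poly_eq0_dense (k : closedFieldType) (p q : {poly k}) :
  q != 0 -> (forall x, q.[x] != 0 -> p.[x] = 0) -> p = 0.
Proof.
move=> q0 pq; apply/eqP/negPn/negP => p0.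
have [x] := poly_nonroot (mulf_neq0 p0 q0).
by rewrite hornerM mulf_eq0 negb_or => /andP[/eqP px /pq].
Qed.

Lemma exists_distinct (k : closedFieldType) n :
  exists2 t : 'I_n -> k, injective t & forall i, t i != 0.
Proof.
have [s [us sn s0]] : exists s : seq k, [/\ uniq s, size s = n & 0 \notin s].
  elim: n => [|n [s [us sn s0]]]; first by exists [::].
  have [x] := @poly_nonroot k (\prod_(a <- 0 :: s) ('X - a%:P))
    (monic_neq0 (monic_prod_XsubC _ _ _)).
  rewrite -/(root _ x) root_prod_XsubC inE negb_or => /andP[x0 xs].
  by exists (x :: s); split; rewrite /= ?xs ?sn // inE negb_or eq_sym x0.
exists (fun i => s`_i) => [i j /eqP|i].
  by rewrite nth_uniq ?sn // => /eqP/val_inj.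
by apply: contraNneq s0 => <-; rewrite mem_nth ?sn.
Qed.

Lemma exists_sqrt (k : closedFieldType) (x : k) : exists r, r ^+ 2 = x.
Proof.
have /closed_rootP[r] : size ('X^2 - x%:P) != 1%N by rewrite size_XnsubC.
by rewrite /root !hornerE subr_eq0 => /eqP rE; exists r.
Qed.

(** The line from [a] to [b], as a function of the variable; it is used to move
degenerate data at 0 to generic data at 1. *)
Definition segment (R : comNzRingType) (a b : R) : {poly R} :=
  (1 - 'X) * a%:P + 'X * b%:P.

Lemma segment0 (R : comNzRingType) (a b : R) : (segment a b).[0] = a.
Proof. by rewrite /segment !hornerE; ring. Qed.

Lemma segment1 (R : comNzRingType) (a b : R) : (segment a b).[1] = b.
Proof. by rewrite /segment !hornerE; ring. Qed.

Lemma base_digits_inj B n (a b : nat -> nat) :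
    (forall i, a i < B)%N -> (forall i, b i < B)%N ->
  (\sum_(i < n) a i * B ^ i = \sum_(i < n) b i * B ^ i)%N ->
  forall i, (i < n)%N -> a i = b i.
Proof.
elim: n a b => [|n IH] a b aB bB //.
have B0 : (0 < B)%N by apply: leq_ltn_trans (aB 0%N).
have split_sum (c : nat -> nat) : (\sum_(i < n.+1) c i * B ^ i =
    (\sum_(i < n) c i.+1 * B ^ i) * B + c 0)%N.
  rewrite big_ord_recl expn0 muln1 addnC; congr addn.
  by rewrite big_distrl /=; apply: eq_bigr => i _; rewrite expnSr mulnA.
rewrite !split_sum => E.
have := congr1 (modn^~ B) E; rewrite /= !modnMDl !modn_small // => E0.
have := congr1 (divn^~ B) E; rewrite /= !divnMDl // !divn_small // !addn0 => E1.
case=> // i; rewrite ltnS.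
exact: (IH (a \o S) (b \o S) (fun j => aB j.+1) (fun j => bB j.+1)).
Qed.

(** Kronecker substitution: ['X_i |-> x^(B^i)] with [B] larger than all exponents
keeps distinct monomials distinct and reduces to one variable. *)
Lemma mpoly_nonroot (k : closedFieldType) n (P : {mpoly k[n]}) :
  P != 0 -> exists v, P.@[v] != 0.
Proof.
move=> P0; pose B := msize P.
pose code (m : 'X_{1..n}) := (\sum_(i < n) m i * B ^ i)%N.
have code_inj : {in msupp P &, injective code}.
  move=> m1 m2 m1P m2P.
  have small m : m \in msupp P -> forall i, (nth 0%N m i < B)%N.
    move=> /msize_mdeg_lt mB i; apply: leq_ltn_trans mB.
    have [i_n|n_i] := ltnP i n; last by rewrite nth_default ?size_tuple.
    by rewrite mdegE (bigD1 (Ordinal i_n)) //= (mnm_nth 0%N) leq_addr.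
  have codeE m : code m = (\sum_(i < n) nth 0 m i * B ^ i)%N.
    by apply: eq_bigr => i _; rewrite (mnm_nth 0%N).
  rewrite !codeE => /(base_digits_inj (small _ m1P) (small _ m2P)) E.
  by apply/mnmP => i; rewrite !(mnm_nth 0%N) E.
pose g := \sum_(m <- msupp P) P@_m *: 'X^(code m) : {poly k}.
have g0 : g != 0.
  have mP := mlead_supp P0.
  apply/eqP => /(congr1 (fun p : {poly k} => p`_(code (mlead P)))) /eqP.
  rewrite coef0 /g coef_sum (bigD1_seq (mlead P)) //= big_seq_cond big1 => [|m].
    by rewrite addr0 coefZ coefXn eqxx mulr1 mcoeff_eq0 mP.
  case/andP=> m_P neq; rewrite coefZ coefXn.
  by case: eqP => [/(code_inj _ _ mP m_P) E|]; rewrite ?mulr0 // -E eqxx in neq *.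
have [x gx] := poly_nonroot g0.
exists (fun i => x ^+ (B ^ i)); move: gx; rewrite mevalE /g horner_sum.
congr (_ != 0); apply: eq_bigr => m _; rewrite hornerZ hornerXn; congr (_ * _).
by rewrite -prodrXr; apply: eq_bigr => i _; rewrite -exprM mulnC.
Qed.

Lemma mpoly_eq0_dense (k : closedFieldType) n (P Q : {mpoly k[n]}) :
  Q != 0 -> (forall v, Q.@[v] != 0 -> P.@[v] = 0) -> P = 0.
Proof.
move=> Q0 PQ; apply/eqP/negPn/negP => P0.
have [v] := mpoly_nonroot (mulf_neq0 P0 Q0).
by rewrite mevalM mulf_eq0 negb_or => /andP[/eqP Pv /PQ].
Qed.

Lemma horner_mmap (k : fieldType) n (f : {mpoly k[n]}) (g : 'I_n -> {poly k}) x :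
  (mmap polyC g f).[x] = f.@[fun i => (g i).[x]].
Proof.
rewrite mevalE /mmap horner_sum; apply: eq_bigr => m _.
rewrite hornerM hornerC horner_prod; congr (_ * _).
by apply: eq_bigr => i _; rewrite horner_exp.
Qed.

(** A polynomial vanishes if through one point [m0] there are, in all tangent
directions [y], curves along which it vanishes: its lowest homogeneous part at
[m0], evaluated at [y], is the leading coefficient along such a curve. In
contrast to the Jacobian criterion, no derivative of [P] is taken, so the
characteristic does not matter. *)
Lemma mpoly_first_order (k : closedFieldType) n (P : {mpoly k[n]}) (m0 : 'I_n -> k) :
  (forall y : 'I_n -> k, exists r : 'I_n -> {poly k},
     mmap polyC (fun i => (m0 i)%:P + 'X * ((y i)%:P + 'X * r i)) P = 0) ->
  P = 0.
Proof.
move=> dirP; apply/eqP/negPn/negP => P0.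
pose Q := P \mPo [tuple (m0 i)%:MP + 'X_i | i < n].
have Q0 : Q != 0.
  have [v Pv] := mpoly_nonroot P0; apply: contraNneq Pv => Q0.
  have := congr1 (meval (fun i => v i - m0 i)) Q0.
  rewrite meval0 comp_mpoly_meval => <-; apply/eqP/meval_eq => i.
  by rewrite tnth_mktuple mevalD mevalC mevalXU addrC subrK.
(* [mlast] is the least monomial for an order refining the degree. *)
pose d := mdeg (mlast Q).
have dQ m : m \in msupp Q -> (d <= mdeg m)%N.
  by move=> /mlast_lemc/lemc_mdeg.
have [y] : exists y, (\sum_(m <- msupp Q | mdeg m == d) Q@_m *: 'X_[m]).@[y] != 0.
  apply: mpoly_nonroot; apply/eqP => /(congr1 (mcoeff (mlast Q))) /eqP.
  have lQ := mlast_supp Q0.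
  rewrite mcoeff0 raddf_sum /= -big_filter (bigD1_seq (mlast Q)) //=; first last.
  - exact/filter_uniq/msupp_uniq.
  - by rewrite mem_filter eqxx.
  rewrite mcoeffZ mcoeffX eqxx mulr1 big1 => [|m mQ].
    by rewrite addr0 mcoeff_eq0 lQ.
  by rewrite mcoeffZ mcoeffX (negPf mQ) mulr0.
have [r] := dirP y; set z := fun i => _ => Pz.
pose w i := (y i)%:P + 'X * r i.
have Qw : mmap polyC (fun i => 'X * w i) Q = 0.
  apply: (@poly_eq0_dense _ _ 1 (oner_neq0 _)) => x _.
  move/(congr1 (horner^~ x)): Pz; rewrite horner0 !horner_mmap => Pz.
  rewrite comp_mpoly_meval -[RHS]Pz; apply: meval_eq => i.
  by rewrite tnth_mktuple mevalD mevalC mevalXU /z hornerD hornerC.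
have : 'X^d * \sum_(m <- msupp Q) (Q@_m)%:P * ('X^(mdeg m - d) * mmap1 w m) = 0.
  rewrite -[RHS]Qw /mmap mulr_sumr big_seq [RHS]big_seq; apply: eq_bigr => m /dQ dm.
  rewrite mulrCA; congr (_ * _).
  rewrite mulrA -exprD subnKC // /mmap1 mdegE -prodrXr -big_split /=.
  by apply: eq_bigr => i _; rewrite exprMn.
move/eqP; rewrite mulf_eq0 -size_poly_eq0 size_polyXn /= => /eqP/(congr1 (horner^~ 0)).
rewrite horner0 horner_sum => Qy; case/eqP.
rewrite -[RHS]Qy raddf_sum /= [RHS](bigID (fun m => mdeg m == d)) /=.
rewrite [X in _ = _ + X]big_seq_cond [X in _ = _ + X]big1 ?addr0 => [|m].
  apply: eq_bigr => m /eqP md; rewrite mevalZ mevalX hornerM hornerC; congr (_ * _).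
  rewrite md subnn mul1r horner_prod; apply: eq_bigr => i _.
  by rewrite horner_exp /w !hornerE.
case/andP=> /dQ; rewrite leq_eqVlt eq_sym => /orP[->//|dm] _.
by rewrite !hornerM hornerXn expr0n subn_eq0 leqNgt dm mul0r mulr0.
Qed.

(** * Algebraic dependence *)
Lemma msupp_prod_mdeg (k : fieldType) n M (F : 'I_M -> {mpoly k[n]}) (a : 'I_M -> nat) E :
    (forall i m, m \in msupp (F i) -> mdeg m <= E)%N ->
  forall m, m \in msupp (\prod_i F i ^+ a i) -> (mdeg m <= (\sum_i a i) * E)%N.
Proof.
move=> FE.
have mulE (p q : {mpoly k[n]}) a1 a2 :
    (forall m, m \in msupp p -> mdeg m <= a1 * E)%N ->
    (forall m, m \in msupp q -> mdeg m <= a2 * E)%N ->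
    forall m, m \in msupp (p * q) -> (mdeg m <= (a1 + a2) * E)%N.
  move=> pE qE m /msuppM_le /allpairsP[[m1 m2] /= [/pE m1E /qE m2E ->]].
  by rewrite mdegD mulnDl leq_add.
have oneE m : m \in msupp (1 : {mpoly k[n]}) -> (mdeg m <= 0 * E)%N.
  by rewrite msupp1 inE => /eqP ->; rewrite mdeg0.
elim/big_rec2: _ => [|i a' p _ IH]; first exact: oneE.
apply: (mulE) IH; elim: (a i) => [|e IHe]; first exact: oneE.
by rewrite exprS -add1n; apply: (mulE) IHe => m; rewrite mul1n; apply: FE.
Qed.

(** Counting: the products of the [F i] with exponents below [K] are [K^M] in
number, and lie in the span of at most [(C K)^N] monomials. For [N < M] and [K]
large the first number wins. *)
Lemma algebraic_dependence (k : fieldType) N M (F : 'I_M -> {mpoly k[N]}) :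
  (N < M)%N -> exists2 P : {mpoly k[M]}, P != 0 & P \mPo [tuple F i | i < M] = 0.
Proof.
move=> NM; pose E := (\max_i msize (F i))%N.
pose C := (M * E).+1; pose K := (C ^ N).+1.
pose I := {ffun 'I_M -> 'I_K}; pose J := {ffun 'I_N -> 'I_(C * K)}.
pose expI (a : I) : 'X_{1..M} := [multinom (a i : nat) | i < M].
pose expJ (b : J) : 'X_{1..N} := [multinom (b j : nat) | j < N].
pose G (a : I) := \prod_i F i ^+ a i.
have Gsmall a m : m \in msupp (G a) -> (mdeg m < C * K)%N.
  have FE i m' : m' \in msupp (F i) -> (mdeg m' <= E)%N.
    move=> /msize_mdeg_lt/ltnW/leq_trans; apply.
    exact: (@leq_bigmax _ (fun i => msize (F i)) i).
  move/(msupp_prod_mdeg FE) => mG; apply: leq_ltn_trans mG _.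
  have : (\sum_i (a i : nat) <= M * K)%N.
    rewrite -[M in (M * _)%N]card_ord -sum_nat_const leq_sum // => i _.
    exact/ltnW/ltn_ord.
  by rewrite /C; move: (\sum_i _)%N => S; rewrite /K; nia.
pose A := \matrix_(i < #|I|, j < #|J|) (G (enum_val i))@_(expJ (enum_val j)).
have cardlt : (#|J| < #|I|)%N.
  rewrite !card_ffun !card_ord expnMn.
  apply: (@leq_trans (K * K ^ N)%N); first by rewrite ltn_pmul2r ?expn_gt0.
  by rewrite -expnS leq_pexp2l.
have /rowV0Pn[v vA v0] : kermx A != 0.
  rewrite -mxrank_eq0 mxrank_ker subn_eq0 -ltnNge.
  exact: leq_ltn_trans (rank_leq_col A) cardlt.
have /rowP vA0 := sub_kermxP vA.
exists (\sum_i v 0 i *: 'X_[expI (enum_val i)]).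
  have /rV0Pn[i0 vi0] := v0.
  apply: contraNneq vi0 => /(congr1 (mcoeff (expI (enum_val i0)))) /=.
  rewrite mcoeff0 raddf_sum /= (bigD1 i0) //= mcoeffZ mcoeffX eqxx mulr1.
  rewrite big1 ?addr0 => [-> //|i i_i0]; rewrite mcoeffZ mcoeffX.
  case: eqP => [/mnmP eqE|]; last by rewrite mulr0.
  case/eqP: i_i0; apply/enum_val_inj/ffunP => j; apply/val_inj.
  by have := eqE j; rewrite !mnmE.
apply/mpolyP => m; rewrite mcoeff0 (raddf_sum (comp_mpoly _)) raddf_sum /=.
have XE i : 'X_[expI (enum_val i)] \mPo [tuple F i | i < M] = G (enum_val i).
  by rewrite comp_mpolyX; apply: eq_bigr => j _; rewrite tnth_mktuple mnmE.
under eq_bigr => i _ do rewrite comp_mpolyZ XE mcoeffZ.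
have [mC|mC] := ltnP (mdeg m) (C * K).
  have mj j : (m j < C * K)%N.
    by apply: leq_ltn_trans mC; rewrite mdegE (bigD1 j) //= leq_addr.
  pose b : J := [ffun j => Ordinal (mj j)].
  have bE : expJ b = m by apply/mnmP => j; rewrite !mnmE ffunE.
  have := vA0 (enum_rank b); rewrite mxE [RHS]mxE => vAb.
  rewrite -[RHS]vAb; apply: eq_bigr => i _.
  by rewrite mxE enum_rankK bE.
apply: big1 => i _; rewrite memN_msupp_eq0 ?mulr0 //.
by apply/negP => /Gsmall; rewrite ltnNge mC.
Qed.

(** * Points on rational normal curves *)
Definition vanishes_on_U (k : closedFieldType) d n (f : coord_ring k d n) : Prop :=
  forall q, U_locus k d n q -> vanishes_at f q.

Lemma V_locusP (k : closedFieldType) d n (p : config k d n) :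
  V_locus k d n p <->
  forall f, multihomog f -> vanishes_on_U f -> vanishes_at f p.
Proof.
split=> [Vp f hf Uf|Vp Z [S Sh ZS] UZ].
  apply: (Vp (fun q => forall g, multihomog g /\ vanishes_on_U g -> vanishes_at g q)).
  - by exists (fun g => multihomog g /\ vanishes_on_U g) => // g [].
  - by move=> q Uq g [_]; apply.
  - by [].
by apply/ZS => f Sf; apply: Vp => [|q /UZ/ZS]; [exact: Sh|apply].
Qed.

(** The row [i] is [c i] times the image under [G] of the Veronese vector of the
point [s i : t i]. The base ring is arbitrary so that the same formula serves for
curves of such matrices and for the generic one; [G] need not be square. *)
Definition rnc_mx (R : comNzRingType) n d e (c s t : 'I_n -> R)
    (G : 'M[R]_(d.+1, e)) : 'M[R]_(n, e) :=
  \matrix_(i, j) (c i * \sum_(l < d.+1) s i ^+ (d - l) * t i ^+ l * G l j).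

Lemma map_rnc_mx (R S : comNzRingType) (phi : {rmorphism R -> S}) n d e
    (c s t : 'I_n -> R) (G : 'M[R]_(d.+1, e)) :
  map_mx phi (rnc_mx c s t G) =
  rnc_mx (phi \o c) (phi \o s) (phi \o t) (map_mx phi G).
Proof.
apply/matrixP => i j; rewrite !mxE rmorphM rmorph_sum; congr (_ * _).
by apply: eq_bigr => l _; rewrite !rmorphM !rmorphXn mxE.
Qed.

Lemma rnc_mxM (R : comNzRingType) n d e e' (c s t : 'I_n -> R)
    (G : 'M[R]_(d.+1, e)) (H : 'M[R]_(e, e')) :
  rnc_mx c s t G *m H = rnc_mx c s t (G *m H).
Proof.
apply/matrixP => i j; rewrite !mxE.
under eq_bigr => l _ do rewrite mxE -mulrA mulr_suml.
rewrite -mulr_sumr exchange_big; congr (_ * _); apply: eq_bigr => l _.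
by rewrite mxE mulr_sumr; apply: eq_bigr => m _; rewrite mulrA.
Qed.

Definition eval_curve (k : closedFieldType) d n (f : coord_ring k d n)
    (Gam : 'M[{poly k}]_(n, d.+1)) : {poly k} := mmap polyC (mxvec Gam 0) f.

Lemma horner_eval_curve (k : closedFieldType) d n (f : coord_ring k d n) Gam x :
  (eval_curve f Gam).[x] = eval_rows f (map_mx (horner_eval x) Gam).
Proof.
rewrite horner_mmap; apply: meval_eq => l.
by case/mxvec_indexP: l => i j; rewrite !mxvecE mxE.
Qed.

Definition row2 (R : nzRingType) (s t : R) : 'rV[R]_2 :=
  \row_j (if j == ord0 then s else t).

(** Under these genericity conditions the rows are the coordinates of a point of
[U], up to a scalar in each row. *)
Lemma vanish_generic_rnc (k : closedFieldType) d n (f : coord_ring k d n)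
    (c s t : 'I_n -> k) (G : 'M[k]_d.+1) :
    (0 < d)%N -> multihomog f -> vanishes_on_U f ->
    (forall i, c i != 0) -> (forall i, s i != 0) ->
    (forall i j, i != j -> s i * t j != s j * t i) -> G \in unitmx ->
  eval_rows f (rnc_mx c s t G) = 0.
Proof.
move=> d0 hf Uf c0 s0 st GU.
have w0 i : row2 (s i) (t i) != 0.
  by apply/eqP => /rowP/(_ ord0); rewrite !mxE => /eqP; rewrite (negPf (s0 i)).
have v0 i : veronese_vec d (row2 (s i) (t i)) *m G != 0.
  apply: contraNneq (veronese_vec_neq0 d (w0 i)) => vG.
  by rewrite -[veronese_vec _ _](mulmxK GU) vG mul0mx.
pose nz m (u : 'rV[k]_m.+1) (u0 : u != 0) : nzvec k m := exist _ u u0.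
pose v i := nz _ _ (v0 i).
pose q : config k d n := [ffun i => proj_class (v i)].
have Uq : U_locus k d n q.
  split=> [i j|].
    rewrite !ffunE => /proj_classP[a a0 /= E].
    apply/eqP/negPn/negP => ij; case/eqP: (st _ _ ij).
    have {}E : veronese_vec d (row2 (s j) (t j)) = a *: veronese_vec d (row2 (s i) (t i)).
      by apply: (can_inj (mulmxK GU)); rewrite E scalemxAl.
    move: E; case: (d) d0 => // d' _ /rowP E.
    have := E (inord 1); have := E ord0; rewrite !mxE !inordK //= !subn0 subSS subn0.
    rewrite !expr0 !expr1 !mulr1 => E0 E1.
    have /mulfI : a * s i ^+ d' * s j ^+ d' != 0.
      by rewrite !mulf_neq0 // expf_neq0.
    apply; transitivity (a * s i ^+ d'.+1 * (s j ^+ d' * t j)); first by rewrite exprS; ring.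
    by rewrite E1 -E0 exprS; ring.
  exists (fun x => exists y, x = projaut GU (veronese d y)); first by exists G, GU.
  move=> i; exists (proj_class (nz _ _ (w0 i))).
  rewrite ffunE (@veronese_class _ _ _ (nz _ _ (veronese_vec_neq0 d (w0 i)))) //.
  by rewrite (@projaut_class _ _ _ _ _ (v i)).
have hq i : exists2 a : k, a != 0 & hcoord (q i) = a *: val (v i).
  by rewrite ffunE; apply: hcoord_class.
have [a a0 qE] := fin_all_exists2 hq.
have b0 i : c i / a i != 0 by rewrite mulf_neq0 ?invr_neq0.
have := Uf q Uq; move/(eval_rowsZ hf _ b0) => E; rewrite -[RHS]E.
congr (eval_rows f _); apply/matrixP => i j; rewrite !mxE qE !mxE.
rewrite mulrA divfK //; congr (_ * _).
by apply: eq_bigr => l _; rewrite !mxE.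
Qed.

Lemma eval_rows_along (k : closedFieldType) d n (f : coord_ring k d n) Gam p :
    p != 0 ->
    (forall x, p.[x] != 0 -> eval_rows f (map_mx (horner_eval x) Gam) = 0) ->
  eval_curve f Gam = 0.
Proof.
move=> p0 pf; apply: poly_eq0_dense p0 _ => x /pf.
by rewrite horner_eval_curve.
Qed.

(** All the parameters are joined by lines to generic ones. Along the lines the
conditions of [vanish_generic_rnc] fail at finitely many points only, so the
equation holds at the starting point too. *)
Lemma vanish_rnc (k : closedFieldType) d n (f : coord_ring k d n)
    (c s t : 'I_n -> k) (G : 'M[k]_d.+1) :
  (0 < d)%N -> multihomog f -> vanishes_on_U f -> eval_rows f (rnc_mx c s t G) = 0.
Proof.
move=> d0 hf Uf; have [tau tau_inj _] := exists_distinct k n.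
pose C i := segment (c i) 1; pose S i := segment (s i) 1.
pose T i := segment (t i) (tau i).
pose Gx : 'M[{poly k}]_d.+1 := \matrix_(i, j) segment (G i j) (1%:M i j).
have mapE x : map_mx (horner_eval x) (rnc_mx C S T Gx) =
    rnc_mx (fun i => (C i).[x]) (fun i => (S i).[x]) (fun i => (T i).[x])
      (map_mx (horner_eval x) Gx) by rewrite map_rnc_mx.
have G0 : map_mx (horner_eval 0) Gx = G.
  by apply/matrixP => i j; rewrite !mxE /horner_eval segment0.
have G1 : map_mx (horner_eval 1) Gx = 1%:M.
  by apply/matrixP => i j; rewrite !mxE /horner_eval segment1.
suff /(congr1 (horner^~ 0)) : eval_curve f (rnc_mx C S T Gx) = 0.
  rewrite horner0 horner_eval_curve mapE G0 => fE; rewrite -[RHS]fE.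
  by congr (eval_rows f _); apply/matrixP => i j; rewrite !mxE !segment0;
    congr (_ * _); apply: eq_bigr => l _; rewrite !segment0.
pose p := \det Gx * \prod_i (C i * S i) *
  \prod_i \prod_(j | i != j) (S i * T j - S j * T i).
have pE x : p.[x] = \det (map_mx (horner_eval x) Gx) *
    \prod_i ((C i).[x] * (S i).[x]) *
    \prod_i \prod_(j | i != j) ((S i).[x] * (T j).[x] - (S j).[x] * (T i).[x]).
  rewrite !hornerM det_map_mx !horner_prod; congr (_ * _ * _).
    by apply: eq_bigr => i _; rewrite hornerM.
  apply: eq_bigr => i _; rewrite horner_prod; apply: eq_bigr => j _.
  by rewrite hornerD hornerN !hornerM.
apply: (@eval_rows_along _ _ _ _ _ p).
  apply: contraTneq isT => /(congr1 (horner^~ 1)) /eqP; rewrite pE horner0 G1 det1 mul1r.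
  rewrite mulf_eq0 => /orP[/prodf_eq0[i _]|/prodf_eq0[i _ /prodf_eq0[j ij]]].
    by rewrite !segment1 mulr1 oner_eq0.
  by rewrite !segment1 !mul1r subr_eq0 => /eqP/tau_inj ji; rewrite ji eqxx in ij.
move=> x; rewrite pE !mulf_eq0 !negb_or => /andP[/andP[Gx0 CS0] /prodf_neq0 ST0].
rewrite mapE; apply: vanish_generic_rnc => // [i|i|i j ij|].
- by move/prodf_neq0/(_ i isT): CS0; rewrite mulf_eq0 negb_or => /andP[].
- by move/prodf_neq0/(_ i isT): CS0; rewrite mulf_eq0 negb_or => /andP[].
- by move/prodf_neq0/(_ j ij): (ST0 i isT); rewrite subr_eq0.
- by rewrite unitmxE unitfE.
Qed.

(** * Multihomogeneous components *)
Section Components.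
Variables (k : closedFieldType) (d n : nat).
Implicit Types (f : coord_ring k d n) (M : 'M[k]_(n, d.+1)).

Definition row_degree (m : 'X_{1..n * d.+1}) : 'X_{1..n} :=
  [multinom (\sum_(j < d.+1) m (mxvec_index i j))%N | i < n].

Definition component (e : 'X_{1..n}) f : coord_ring k d n :=
  \sum_(m <- msupp f | row_degree m == e) f@_m *: 'X_[m].

Lemma component_multihomog e f : multihomog (component e f).
Proof.
exists e => m; rewrite mcoeff_msupp /component raddf_sum /= => m0 i.
suff <- : row_degree m = e by rewrite mnmE.
apply/eqP; apply: contraNT m0 => me; rewrite big1 // => m' m'e.
by rewrite mcoeffZ mcoeffX; case: eqP => [E|]; rewrite ?mulr0 // -E m'e in me *.
Qed.

(** The equation [f] on the matrices obtained from [M] by scaling its rows, as a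
polynomial in the scaling factors. Its coefficients are the values at [M] of the
multihomogeneous components of [f], which is how these are separated. *)
Definition row_scaling f M : {mpoly k[n]} :=
  \sum_(m <- msupp f) ('X_[m] : coord_ring k d n).@[mxvec M 0] *:
    (f@_m *: 'X_[row_degree m]).

Lemma row_scalingE f M c :
  (row_scaling f M).@[c] = eval_rows f (\matrix_i (c i *: row i M)).
Proof.
rewrite /eval_rows [RHS]mevalE /row_scaling (raddf_sum (meval c)) /=.
apply: eq_bigr => m _.
rewrite !mevalZ !mevalX mulrCA; congr (_ * _).
have prodE (F : 'I_(n * d.+1) -> k) :
    \prod_l F l = \prod_i \prod_(j < d.+1) F (mxvec_index i j).
  rewrite pair_bigA /= (reindex (uncurry (@mxvec_index n d.+1))) /=.
    by apply: eq_bigr => -[].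
  exact: (curry_mxvec_bij n d.+1).
rewrite !prodE -big_split /=; apply: eq_bigr => i _.
rewrite mnmE -prodrXr -big_split /=; apply: eq_bigr => j _.
by rewrite !mxvecE !mxE exprMn mulrC.
Qed.

Lemma mcoeff_row_scaling f M e :
  (row_scaling f M)@_e = eval_rows (component e f) M.
Proof.
rewrite /eval_rows /component /row_scaling (raddf_sum (meval _)) raddf_sum /=.
rewrite [RHS]big_mkcond; apply: eq_bigr => m _.
rewrite !mcoeffZ mcoeffX mevalZ; case: eqP => _; last by rewrite !mulr0.
by rewrite mulr1 mulrC.
Qed.

(** The closure is defined by multihomogeneous equations, but any polynomial that
vanishes on [U], for all choices of coordinate vectors, may be used. *)
Lemma V_locus_vanish f (p : config k d n) :
    (forall q c, U_locus k d n q -> (forall i, c i != 0) ->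
       eval_rows f (\matrix_i (c i *: hcoord (q i))) = 0) ->
    V_locus k d n p ->
  forall c, eval_rows f (\matrix_i (c i *: hcoord (p i))) = 0.
Proof.
move=> Uf /V_locusP Vp c.
have scaleE (q : config k d n) b : \matrix_i (b i *: hcoord (q i)) =
    \matrix_i (b i *: row i (\matrix_j hcoord (q j))).
  by apply/matrixP => i j; rewrite !mxE.
rewrite scaleE -row_scalingE.
suff -> : row_scaling f (\matrix_i hcoord (p i)) = 0 by rewrite meval0.
apply/mpolyP => e; rewrite mcoeff_row_scaling mcoeff0.
apply: Vp (component_multihomog e f) _ => q Uq.
rewrite /vanishes_at -mcoeff_row_scaling.
suff -> : row_scaling f (\matrix_i hcoord (q i)) = 0 by rewrite mcoeff0.
apply: (@mpoly_eq0_dense _ _ _ (\prod_i 'X_i)) => [|b].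
  by apply/prodf_neq0 => i _; rewrite -msize_poly_eq0 msizeX.
rewrite rmorph_prod /= => /prodf_neq0 b0; rewrite row_scalingE -scaleE.
by apply: Uf => // i; have := b0 i isT; rewrite mevalXU.
Qed.

End Components.

(** * Fixing three parameters of the curve *)
Section Substitution.
Variable k : closedFieldType.

Definition binary_form m (a : {poly k}) (x y : k) :=
  \sum_(l < m.+1) x ^+ (m - l) * y ^+ l * a`_l.

Lemma binary_formM m (a : {poly k}) al be x y : (size a <= m.+1)%N ->
  binary_form m.+1 (a * (al%:P + be *: 'X)) x y =
  binary_form m a x y * (x * al + y * be).
Proof.
move=> sa; rewrite mulrDr /binary_form.
under eq_bigr => l _ do rewrite coefD coefMC -scalerAr coefZ coefMX mulrDr.
rewrite big_split /= big_ord_recr /= (nth_default _ sa) mul0r mulr0 addr0.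
rewrite [X in _ + X]big_ord_recl /= mulr0 mulr0 add0r mulrDr !mulr_suml.
congr (_ + _); apply: eq_bigr => l _.
  by have lm : (l <= m)%N := ltn_ord l; rewrite subSn // exprS; ring.
by rewrite subSS /bump leq0n add1n exprS /=; ring.
Qed.

(** A linear substitution of the two parameters acts linearly on the forms of
degree [d]; column [j] of [g] has the coefficients of the form obtained from the
monomial [j]. *)
Lemma veronese_subst d (h : 'M[k]_2) : exists g : 'M[k]_d.+1,
  forall v, veronese_vec d (v *m h) = veronese_vec d v *m g.
Proof.
pose L (j : 'I_2) := (h ord0 j)%:P + h ord_max j *: 'X.
pose P e j := L ord0 ^+ e * L ord_max ^+ j.
have sL j : (size (L j) <= 2)%N.
  rewrite (leq_trans (size_polyD _ _)) // geq_max (leq_trans (size_polyC_leq1 _)) //=.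
  by rewrite (leq_trans (size_scale_leq _ _)) ?size_polyX.
have sLM (a : {poly k}) m j : (size a <= m.+1 -> size (a * L j)%R <= m.+2)%N.
  move=> sa; rewrite (leq_trans (size_polyMleq _ _)) //.
  by have := sL j; lia.
have PE e j : (size (P e j) <= (e + j).+1)%N /\
    forall x y, binary_form (e + j) (P e j) x y =
      (x * h ord0 ord0 + y * h ord_max ord0) ^+ e *
      (x * h ord0 ord_max + y * h ord_max ord_max) ^+ j.
  elim: j => [|j [sP IH]].
    rewrite addn0 /P expr0 mulr1; elim: e => [|e [sP IH]].
      rewrite expr0 size_polyC oner_eq0; split=> // x y.
      by rewrite /binary_form big_ord1 !expr0 coefC !mulr1.
    rewrite exprSr; split; first exact: sLM.
    by move=> x y; rewrite binary_formM // IH; rewrite !expr0 !mulr1 exprSr.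
  rewrite addnS /P exprSr mulrA; split; first exact: sLM.
  by move=> x y; rewrite binary_formM // IH exprSr mulrA.
exists (\matrix_(l, j) (P (d - j)%N j)`_l) => v; apply/rowP => j.
have vhE j' : (v *m h) 0 j' = v 0 ord0 * h ord0 j' + v 0 ord_max * h ord_max j'.
  by rewrite mxE big_ord_recl big_ord1; congr (_ + v 0 _ * h _ _); apply: val_inj.
have jd : (j <= d)%N := ltn_ord j.
have [_] := PE (d - j)%N j; rewrite subnK // => E.
rewrite [LHS]mxE !vhE -E [RHS]mxE; apply: eq_bigr => l _.
by rewrite !mxE.
Qed.

End Substitution.

Section NormalForm.
Variables (k : closedFieldType) (d n : nat).

Definition det2 (v w : 'rV[k]_2) := v 0 ord0 * w 0 ord_max - v 0 ord_max * w 0 ord0.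

Lemma row2_ext (v w : 'rV[k]_2) :
  v 0 ord0 = w 0 ord0 -> v 0 ord_max = w 0 ord_max -> v = w.
Proof.
move=> E0 E1; apply/rowP => j.
by case: j => [[|[|//]] j2]; [move: E0 | move: E1]; congr (v 0 _ = w 0 _); apply: val_inj.
Qed.

Lemma det2_eq0 (y z : proj k 1) : det2 (hcoord y) (hcoord z) = 0 -> y = z.
Proof.
rewrite /det2 => /eqP; rewrite subr_eq0 => /eqP E.
suff [c zE] : exists c, hcoord z = c *: hcoord y.
  rewrite -[y]reprK -[z]reprK; apply/proj_classP; exists c => //.
  by apply: contraNneq (hcoord_neq0 z) => c0; rewrite zE c0 scale0r.
have [y0|y0] := eqVneq (hcoord y 0 ord0) 0.
  have y1 : hcoord y 0 ord_max != 0.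
    apply: contraNneq (hcoord_neq0 y) => y1; apply/eqP.
    by apply: row2_ext; rewrite ?y0 ?y1 mxE.
  exists (hcoord z 0 ord_max / hcoord y 0 ord_max); apply: row2_ext; rewrite mxE.
    apply: (mulfI y1); rewrite -E y0; ring.
  by field.
exists (hcoord z 0 ord0 / hcoord y 0 ord0); apply: row2_ext; rewrite mxE.
  by field.
by apply: (mulfI y0); rewrite E; field.
Qed.

Lemma det2_expand (v w0 w1 : 'rV[k]_2) j :
  det2 w0 w1 * v 0 j = det2 v w1 * w0 0 j - det2 v w0 * w1 0 j.
Proof.
have : (j == ord0) || (j == ord_max) by case: j => [[|[|]]].
by case/orP => /eqP ->; rewrite /det2; ring.
Qed.

(** The points number 0, 1, 2 get the parameters (0 : 1), (1 : 0), (1 : 1), and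
all the others get a parameter with first coordinate 1. *)
Definition fixed_s (R : nzRingType) n (i : 'I_n) : R := (i != 0 :> nat)%:R.
Definition fixed_t (R : nzRingType) n (i : 'I_n) : R := (i != 1 :> nat)%:R.

(** Three points of the line can be moved to any three points, and the scalar
[c 0] can be absorbed in [G]. This removes the 4 dimensions of GL_2 from the
parameters, which the dimension count cannot afford to keep. *)
Lemma U_locus_normal_form (q : config k d n) (b : 'I_n -> k) :
    (2 < n)%N -> U_locus k d n q -> (forall i, b i != 0) ->
  exists c t (G : 'M[k]_d.+1),
    [/\ \matrix_i (b i *: hcoord (q i)) = rnc_mx c (@fixed_s k n) t G,
        forall i : 'I_n, val i = 0%N -> c i = 1 &
        forall i : 'I_n, (i <= 2)%N -> t i = fixed_t k i].
Proof.
move=> n2 [q_inj [C [g [gU gC]] Cq]] b0.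
have /fin_all_exists[y yE] i : exists y, q i = projaut gU (veronese d y).
  exact/gC.
pose v i := hcoord (y i).
have v_indep i j : i != j -> det2 (v i) (v j) != 0.
  by move=> ij; apply/eqP => /det2_eq0 E; case/eqP: ij; apply: q_inj; rewrite !yE E.
have /fin_all_exists2[e e0 eE] i : exists2 e : k, e != 0 &
    hcoord (q i) = e *: (veronese_vec d (v i) *m g).
  rewrite yE /projaut; set w := exist _ _ _; have [e1 e10 ->] := hcoord_class w.
  rewrite /= /veronese; set u := exist _ _ _; have [e2 e20 ->] := hcoord_class u.
  rewrite /= -scalemxAl scalerA.
  by exists (e1 * e2); rewrite ?mulf_neq0.
pose i0 := Ordinal (ltn_trans (isT : 0 < 2)%N n2).
pose i1 := Ordinal (ltn_trans (isT : 1 < 2)%N n2).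
pose i2 := Ordinal n2.
pose D01 := det2 (v i0) (v i1); pose D21 := det2 (v i2) (v i1).
pose D20 := det2 (v i2) (v i0).
have D01n : D01 != 0 by exact: v_indep.
have D21n : D21 != 0 by exact: v_indep.
have D20n : D20 != 0 by exact: v_indep.
(* The coordinates in which [v i0], [v i1] lie on the axes and [v i2] is (1, 1). *)
pose s i := det2 (v i) (v i0) / D20.
pose t i := det2 (v i) (v i1) / D21.
pose h : 'M[k]_2 := \matrix_(i, j)
  (if i == ord0 then - D20 / D01 * v i1 0 j else D21 / D01 * v i0 0 j).
pose t' i := if i == i0 then 1 else t i / s i.
pose a i := if i == i0 then t i else s i.
have sn i : i != i0 -> s i != 0 by move=> ii0; rewrite mulf_neq0 ?invr_neq0 ?v_indep.
have an i : a i != 0.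
  rewrite /a; case: (eqVneq i i0) => [->|/sn //].
  by rewrite mulf_neq0 ?invr_neq0 ?v_indep.
have vE i : v i = a i *: (row2 (fixed_s k i) (t' i) *m h).
  have -> : v i = row2 (s i) (t i) *m h.
    apply/rowP => j; rewrite mxE big_ord_recl big_ord1 !mxE /=.
    have /eqP := det2_expand (v i) (v i0) (v i1) j; rewrite -/D01.
    rewrite -subr_eq0 => /eqP E; apply: (mulfI D01n); apply/eqP.
    by rewrite -subr_eq0 -E /s /t -/D20 -/D21; apply/eqP; field; rewrite D01n D20n D21n.
  rewrite scalemxAl; congr (_ *m h); apply: row2_ext; rewrite !mxE /=.
    rewrite /fixed_s /a -[val i == 0%N]/(i == i0); case: (eqVneq i i0) => [->|_].
      by rewrite mulr0 /s /det2; ring.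
    by rewrite mulr1.
  rewrite /a /t'; case: (eqVneq i i0) => [->|/sn ?]; first by rewrite mulr1.
  by rewrite mulrCA divff ?mulr1.
have [gh ghE] := veronese_subst d h.
pose c i := b i * e i * a i ^+ d.
have c0 i : c i != 0 by rewrite !mulf_neq0 // expf_neq0.
exists (fun i => c i / c i0), t', (c i0 *: (gh *m g)); split.
- apply/matrixP => i j; rewrite mxE eE vE veronese_vecZ ghE -!scalemxAl !scalerA -mulmxA.
  rewrite mxE [X in _ * X]mxE [RHS]mxE -[in RHS]mulrA; congr (_ * _).
  rewrite mulr_sumr; apply: eq_bigr => l _.
  rewrite [X in _ * X = _]mxE [veronese_vec _ _ _ _]mxE !mxE.
  by rewrite [RHS]mulrCA mulKf.
- by move=> i i_0; rewrite (_ : i = i0) ?divff //; apply: val_inj.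
- move=> i; rewrite /fixed_t /t' => i_2.
  case: (eqVneq i i0) => [->//|ii0].
  have [ii1|ii1] := eqVneq i i1.
    by rewrite ii1 /t /det2 /=; ring.
  have -> : i = i2.
    apply: val_inj; move: ii0 ii1 i_2; rewrite -!val_eqE /=; lia.
  by rewrite /t /s -/D21 -/D20 divff // divff // divr1.
Qed.

End NormalForm.

(** * Counting dimensions *)
(** [e] is the least exponent of ['X_z] among the monomials of [P]. *)
Lemma mpoly_factor_var (k : fieldType) M (P : {mpoly k[M]}) (z : 'I_M) : P != 0 ->
  exists e (P' : {mpoly k[M]}), P = P' * 'X_z ^+ e /\
    P' \mPo [tuple if i == z then 0 else 'X_i | i < M] != 0.
Proof.
move=> P0.
have exP : exists e, has (fun m : 'X_{1..M} => m z == e) (msupp P).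
  by exists (mlead P z); apply/hasP; exists (mlead P); rewrite ?mlead_supp.
case: (ex_minnP exP) => e /hasP[m1 m1P /eqP m1e] emin.
have ele m : m \in msupp P -> (e <= m z)%N.
  by move=> mP; apply: emin; apply/hasP; exists m.
pose low (m : 'X_{1..M}) := [multinom if i == z then (m i - e)%N else m i | i < M].
have lowE (S : comNzRingType) (x : 'I_M -> S) (m : 'X_{1..M}) : (e <= m z)%N ->
    \prod_i x i ^+ m i = (\prod_i x i ^+ low m i) * x z ^+ e.
  move=> em; rewrite (bigD1 z) //= [X in _ = X * _](bigD1 z) //= mnmE eqxx mulrAC -exprD.
  rewrite subnK //; congr (_ * _); apply: eq_bigr => i iz.
  by rewrite mnmE (negPf iz).
exists e, (\sum_(m <- msupp P) P@_m *: 'X_[low m]); split.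
  rewrite [LHS]mpolyE mulr_suml big_seq [RHS]big_seq; apply: eq_bigr => m mP.
  rewrite -scalerAl; congr (_ *: _); rewrite mpolyXE_id lowE ?ele //.
  by rewrite -mpolyXE_id.
rewrite (raddf_sum (comp_mpoly _)) /=.
apply/eqP => /(congr1 (mcoeff (low m1))); rewrite mcoeff0 raddf_sum /=.
rewrite (bigD1_seq m1) ?msupp_uniq //= big_seq_cond big1 ?addr0 => [|m /andP[mP mm1]].
  rewrite comp_mpolyZ mcoeffZ comp_mpolyX.
  under eq_bigr => i _ do rewrite tnth_mktuple.
  suff -> : \prod_i (if i == z then 0 else 'X_i) ^+ low m1 i = 'X_[low m1] :> {mpoly k[M]}.
    by rewrite mcoeffX eqxx mulr1; apply/eqP; rewrite mcoeff_eq0 m1P.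
  rewrite [RHS]mpolyXE_id; apply: eq_bigr => i _; rewrite mnmE.
  by case: eqP => // ->; rewrite m1e subnn !expr0.
rewrite comp_mpolyZ mcoeffZ comp_mpolyX.
under eq_bigr => i _ do rewrite tnth_mktuple.
have [mz|mz] := eqVneq (m z) e; last first.
  rewrite (bigD1 z) //= eqxx mnmE eqxx expr0n.
  by rewrite subn_eq0 leqNgt ltn_neqAle eq_sym mz ele //= mul0r mcoeff0 mulr0.
suff -> : \prod_i (if i == z then 0 else 'X_i) ^+ low m i = 'X_[low m] :> {mpoly k[M]}.
  rewrite mcoeffX; case: eqP => [/mnmP E|]; rewrite ?mulr0 //.
  case/eqP: mm1; apply/mnmP => i; have := E i; rewrite !mnmE.
  by case: eqP => // -> _; rewrite mz m1e.
rewrite [RHS]mpolyXE_id; apply: eq_bigr => i _; rewrite mnmE.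
by case: eqP => // ->; rewrite mz subnn !expr0.
Qed.

Section Count.
Variables (k : closedFieldType) (d n : nat).

(** The parameters of the normal form: the entries of [G], the factors [c i] with
[0 < i] and the [t i] with [2 < i]. *)
Definition param : finType :=
  ('I_d.+1 * 'I_d.+1 + {i : 'I_n | 0 < i}%N + {i : 'I_n | 2 < i}%N)%type.

Lemma card_ord_gt m : #|{: {i : 'I_n | m < i}%N}| = (n - m.+1)%N.
Proof.
rewrite card_sig -sum1_card -(big_geq_mkord _ _ xpredT (fun=> 1%N)) /=.
by rewrite sum_nat_const_nat muln1.
Qed.

Lemma card_param : #|param| = (d.+1 * d.+1 + (n - 1) + (n - 3))%N.
Proof. by rewrite !card_sum card_prod !card_ord !card_ord_gt; lia. Qed.

Let R := {mpoly k[#|param|]}.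
Let var (x : param) : R := 'X_(enum_rank x).

Definition generic_c (i : 'I_n) : R :=
  if insub i is Some u then var (inl (inr u)) else 1.
Definition generic_t (i : 'I_n) : R :=
  if insub i is Some u then var (inr u) else fixed_t R i.
Definition generic_G : 'M[R]_d.+1 := \matrix_(i, j) var (inl (inl (i, j))).
Definition generic_rnc : 'M[R]_(n, d.+1) :=
  rnc_mx generic_c (@fixed_s R n) generic_t generic_G.

Lemma specialize_rnc (c t : 'I_n -> k) (G : 'M[k]_d.+1) :
    (forall i : 'I_n, val i = 0%N -> c i = 1) ->
    (forall i : 'I_n, (i <= 2)%N -> t i = fixed_t k i) ->
  exists a, rnc_mx c (@fixed_s k n) t G = map_mx (meval a) generic_rnc.
Proof.
move=> c0 t2.
pose a (x : param) := match x with
  | inl (inl (i, j)) => G i j | inl (inr u) => c (val u) | inr u => t (val u) end.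
exists (fun l => a (enum_val l)); rewrite map_rnc_mx.
have varE x : (var x).@[fun l => a (enum_val l)] = a x by rewrite mevalXU enum_rankK.
have -> : map_mx (meval (fun l => a (enum_val l))) generic_G = G.
  by apply/matrixP => i j; rewrite !mxE varE.
apply/matrixP => i j; rewrite !mxE /=; congr (_ * _).
  rewrite /generic_c; case: insubP => [u _ <-|]; first by rewrite varE.
  by rewrite -eqn0Ngt meval1 => /eqP/c0.
apply: eq_bigr => l _; congr (_ ^+ _ * _ ^+ _ * _).
  by rewrite /fixed_s rmorph_nat.
rewrite /generic_t; case: insubP => [u _ <-|]; first by rewrite varE.
by rewrite -leqNgt /fixed_t rmorph_nat => /t2.
Qed.

Hypotheses (n3 : (2 < n)%N) (dn : (d + 2 <= n)%N).

Lemma widen_dn : (d <= n)%N.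
Proof. exact: leq_trans (leq_addr _ _) dn. Qed.

(** Row 0 is avoided, since there [s] vanishes; the rows from 1 on give a genuine
Vandermonde matrix. *)
Definition next_row (i : 'I_d.+1) : 'I_n := insubd (Ordinal n3) i.+1.

Lemma next_rowE i : val (next_row i) = i.+1.
Proof. by rewrite /next_row val_insubd; have := ltn_ord i; case: ifP => //; lia. Qed.

(** Entries that can be prescribed on a matrix of rank at most [d] with invertible
upper left block, and one maximal minor: the first [d] columns are arbitrary, and
the last one is determined by its first [d] entries. *)
Definition obs : finType := ('I_n * 'I_d + 'I_d + unit)%type.

Definition observe (S : comNzRingType) (M : 'M[S]_(n, d.+1)) (x : obs) : S :=
  match x with
  | inl (inl (i, j)) => M i (widen_ord (leqnSn d) j)
  | inl (inr i) => M (widen_ord widen_dn i) ord_max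
  | inr _ => \det (rowsub next_row M)
  end.

Lemma card_obs : #|obs| = (n * d + d).+1.
Proof. by rewrite !card_sum card_prod !card_ord card_unit addn1. Qed.

Lemma observe_map (S S' : comNzRingType) (phi : {rmorphism S -> S'}) M x :
  observe (map_mx phi M) x = phi (observe M x).
Proof.
case: x => [[[i j]|i]|[]] /=; rewrite ?mxE //.
by rewrite -map_mxsub det_map_mx.
Qed.

Lemma generic_minor_neq0 : observe generic_rnc (inr tt) != 0.
Proof.
have [tau tau_inj _] := exists_distinct k n.
pose i1 := Ordinal (ltn_trans (isT : 1 < 2)%N n3); pose i2 := Ordinal n3.
have t12 : tau i2 - tau i1 != 0 by rewrite subr_eq0 (inj_eq tau_inj).
pose t i := if val i == 0%N then 1 else (tau i - tau i1) / (tau i2 - tau i1).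
have [a rncE] : exists a, rnc_mx (fun=> 1) (@fixed_s k n) t 1%:M
    = map_mx (meval a) generic_rnc.
  apply: specialize_rnc => // i i_2; rewrite /t /fixed_t.
  case: eqP => [->//|/eqP i0].
  have [i_1|i_1] := eqVneq (val i) 1%N.
    by rewrite (_ : i = i1) ?subrr ?mul0r //; apply: val_inj.
  by rewrite (_ : i = i2) ?divff //; apply: val_inj; move: i_2 i0 i_1 => /=; lia.
suff : observe (rnc_mx (fun=> 1) (@fixed_s k n) t 1%:M) (inr tt) != 0.
  by apply: contraNneq => o0; rewrite rncE observe_map o0 rmorph0.
have /= -> : rowsub next_row (rnc_mx (fun=> 1) (@fixed_s k n) t (1%:M : 'M[k]_d.+1)) =
    (Vandermonde d.+1 (\row_i t (next_row i)))^T.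
  apply/matrixP => i j; rewrite !mxE /fixed_s next_rowE /= mul1r.
  rewrite (bigD1 j) //= big1 ?addr0 => [|l lj]; rewrite !mxE expr1n mul1r.
    by rewrite eqxx mulr1.
  by rewrite (negPf lj) mulr0.
rewrite det_tr det_Vandermonde; apply/prodf_neq0 => i _; apply/prodf_neq0 => j ij.
rewrite !mxE /t !next_rowE /= subr_eq0 -subr_eq0 -mulrBl mulf_neq0 ?invr_neq0 //.
rewrite opprB addrA subrK subr_eq0 (inj_eq tau_inj) -val_eqE !next_rowE.
by rewrite eqSS gtn_eqF.
Qed.

End Count.

Lemma det_factor_eq0 (k : fieldType) d (A : 'M[k]_(d.+1, d)) (B : 'M[k]_(d, d.+1)) :
  \det (A *m B) = 0.
Proof.
apply/eqP/negPn; rewrite -unitfE -unitmxE -row_free_unit /row_free.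
by rewrite neq_ltn ltnS (leq_trans (mxrankM_maxl _ _)) ?rank_leq_col.
Qed.

Lemma Y_locus_of_factor (k : closedFieldType) d n (p : config k d n) c
    (A : 'M[k]_(n, d)) (B : 'M[k]_(d, d.+1)) :
  (forall i, hcoord (p i) = c i *: row i (A *m B)) -> Y_locus k d n p.
Proof.
move=> pE s _; rewrite -det_tr.
have -> : (colsub s (coord_mx p))^T = (\matrix_(i, j) (c (s i) * A (s i) j)) *m B.
  apply/matrixP => i j; rewrite !mxE pE !mxE mulr_sumr.
  by apply: eq_bigr => l _; rewrite !mxE mulrA.
exact: det_factor_eq0.
Qed.

Section Dimension.
Variables (k : closedFieldType) (d n : nat).
Hypotheses (n3 : (2 < n)%N) (dn : (d + 2 <= n)%N) (d0 : (0 < d)%N).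
Hypothesis param_lt_obs : (#|param d n| < #|obs d n|)%N.

Let z : 'I_#|obs d n| := enum_rank (inr tt).

(** The minor is not zero on the generic matrix, so a relation can be divided by a
power of it until some term is free of the minor. *)
Lemma observe_dependence : exists (P : {mpoly k[#|obs d n|]}),
  P \mPo [tuple observe n3 dn (generic_rnc k d n) (enum_val i) | i < #|obs d n|] = 0 /\
  P \mPo [tuple if i == z then 0 else 'X_i | i < #|obs d n|] != 0.
Proof.
have [P P0 PE] := @algebraic_dependence k _ _
  (fun i : 'I_#|obs d n| => observe n3 dn (generic_rnc k d n) (enum_val i)) param_lt_obs.
have [e [P' [P'E P'0]]] := mpoly_factor_var z P0.
exists P'; split=> //; apply/eqP.
move: PE; rewrite P'E rmorphM rmorphXn /= comp_mpolyXU -tnth_nth tnth_mktuple.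
rewrite enum_rankK => /eqP; rewrite mulf_eq0 => /orP[//|].
by rewrite expf_eq0 (negPf (generic_minor_neq0 k n3 dn)) andbF.
Qed.

(** A point of [Y] at which the prescribed entries are generic. The last column of
[A *m B] is the combination of the columns of [A] determined by the first [d]
rows. *)
Lemma Y_point (Q : {mpoly k[#|obs d n|]}) : Q != 0 ->
  exists v (A : 'M[k]_(n, d)) (B : 'M[k]_(d, d.+1)),
    [/\ Q.@[v] != 0, forall i, row i (A *m B) != 0 &
        forall i, observe n3 dn (A *m B) (enum_val i) = if i == z then 0 else v i].
Proof.
move=> Q0.
pose X (x : obs d n) : {mpoly k[#|obs d n|]} := 'X_(enum_rank x).
pose top : 'M[{mpoly k[#|obs d n|]}]_d :=
  \matrix_(i, j) X (inl (inl (widen_ord (widen_dn dn) i, j))).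
pose o0 : 'I_d := Ordinal d0.
have X0 x : X x != 0 by rewrite -msize_poly_eq0 msizeX.
pose xv (v : 'I_#|obs d n| -> k) x := v (enum_rank x).
have XE v x : (X x).@[v] = xv v x by rewrite mevalXU.
have top0 : \det top != 0.
  apply/eqP => /(congr1 (meval (fun l =>
    match enum_val l with inl (inl (i, j)) => (val i == val j)%:R | _ => 0 end))).
  rewrite meval0 -det_map_mx (_ : map_mx _ _ = 1%:M) ?det1 => [/eqP|].
    by rewrite oner_eq0.
  by apply/matrixP => i j; rewrite !mxE /= XE /xv enum_rankK.
have col0 : \prod_i X (inl (inl (i, o0))) != 0 by apply/prodf_neq0 => i _; apply: X0.
have [v] := mpoly_nonroot (mulf_neq0 (mulf_neq0 Q0 top0) col0).
rewrite !mevalM !mulf_eq0 !negb_or rmorph_prod /= => /andP[/andP[Qv topv] /prodf_neq0 v0].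
pose A : 'M[k]_(n, d) := \matrix_(i, j) xv v (inl (inl (i, j))).
pose w : 'cV[k]_d := \col_i xv v (inl (inr i)).
pose topA := rowsub (widen_ord (widen_dn dn)) A.
have topA_unit : topA \in unitmx.
  rewrite unitmxE unitfE (_ : topA = map_mx (meval v) top) ?det_map_mx //.
  by apply/matrixP => i j; rewrite !mxE XE.
pose B : 'M[k]_(d, d.+1) :=
  \matrix_(i, j) (if unlift ord_max j is Some j' then (i == j')%:R
                  else (invmx topA *m w) i 0).
have ABl i j : (A *m B) i (widen_ord (leqnSn d) j) = A i j.
  have jE : widen_ord (leqnSn d) j = lift ord_max j.
    by apply: val_inj; rewrite /= /bump leqNgt ltn_ord.
  rewrite jE mxE (bigD1 j) //= big1 ?addr0 => [|l lj]; rewrite !mxE liftK.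
    by rewrite eqxx mulr1.
  by rewrite (negPf lj) mulr0.
exists v, A, B; split=> // i.
  have := v0 i isT; apply: contraNneq => /rowP/(_ (widen_ord (leqnSn d) o0)).
  by rewrite [LHS]mxE ABl mxE [RHS]mxE XE => ->.
have [->|iz] := eqVneq i z.
  by rewrite enum_rankK /= -mul_rowsub_mx det_factor_eq0.
rewrite -[in RHS](enum_valK i); case: (enum_val i) (enum_valK i) => [[[i' j]|i']|[]] iE.
- by rewrite /= ABl mxE.
- rewrite /=; transitivity ((topA *m (invmx topA *m w)) i' 0).
    rewrite !mxE; apply: eq_bigr => l _; rewrite [B _ _]mxE unlift_none.
    by rewrite [topA _ _]mxE.
  by rewrite mulKVmx // mxE.
- by rewrite -iE eqxx in iz.
Qed.

Lemma Y_not_sub_V : exists2 p, Y_locus k d n p & ~ V_locus k d n p.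
Proof.
have [P [PU PY]] := observe_dependence.
have [v [A [B [Pv AB0 ABv]]]] := Y_point PY.
pose X : 'M[coord_ring k d n]_(n, d.+1) := \matrix_(i, j) 'X_(mxvec_index i j).
pose F : coord_ring k d n :=
  P \mPo [tuple observe n3 dn X (enum_val i) | i < #|obs d n|].
have FE M : eval_rows F M = P.@[fun i => observe n3 dn M (enum_val i)].
  rewrite /eval_rows comp_mpoly_meval; apply: meval_eq => i.
  rewrite tnth_mktuple -observe_map; congr (observe n3 dn _ _).
  by apply/matrixP => i' j; rewrite mxE [X _ _]mxE /= mevalXU mxvecE.
pose nz (u : 'rV[k]_d.+1) (u0 : u != 0) : nzvec k d := exist _ u u0.
pose p : config k d n := [ffun i => proj_class (nz _ (AB0 i))].
have /fin_all_exists2[c c0 pE] i : exists2 c : k, c != 0 & hcoord (p i) = c *: row i (A *m B).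
  by rewrite ffunE; apply: (hcoord_class (nz _ (AB0 i))).
exists p; first exact: Y_locus_of_factor pE.
move=> Vp; have : eval_rows F (\matrix_i ((c i)^-1 *: hcoord (p i))) = 0.
  apply: V_locus_vanish Vp _ => q b Uq b0.
  have [c' [t [G [-> c'0 t2]]]] := U_locus_normal_form n3 Uq b0.
  have [a ->] := specialize_rnc G c'0 t2.
  rewrite FE -(meval0 a) -PU comp_mpoly_meval; apply: meval_eq => i.
  by rewrite tnth_mktuple observe_map.
have -> : \matrix_i ((c i)^-1 *: hcoord (p i)) = A *m B.
  by apply/row_matrixP => i; rewrite rowK pE scalerA mulVf // scale1r.
rewrite FE => /eqP; apply/negP; move: Pv; rewrite comp_mpoly_meval.
congr (_ != 0); apply: meval_eq => i; rewrite tnth_mktuple ABv.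
by case: eqP => _; rewrite ?meval0 ?mevalXU.
Qed.

End Dimension.

(** * Coplanar points and nodal cubics *)
(** Up to a scalar, the Lagrange interpolation polynomial of the node [t i]. *)
Definition node_poly (R : nzRingType) n (t : 'I_n -> R) (i : 'I_n) : {poly R} :=
  \prod_(j | j != i) ('X - (t j)%:P).

Lemma size_node_poly (k : fieldType) n (t : 'I_n -> k) i : size (node_poly t i) = n.
Proof.
rewrite /node_poly (eq_bigl (mem (predC1 i))) // -big_enum size_prod_XsubC -cardE.
by rewrite cardC1 card_ord prednK // (leq_ltn_trans _ (ltn_ord i)).
Qed.

Lemma horner_sum_node_poly (k : fieldType) n (t w : 'I_n -> k) i :
  (\sum_j w j *: node_poly t j).[t i] = w i * \prod_(j | j != i) (t i - t j).
Proof.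
rewrite horner_sum (bigD1 i) //= big1 => [|j ji].
  rewrite addr0 hornerZ horner_prod; congr (_ * _).
  by apply: eq_bigr => j _; rewrite hornerXsubC.
rewrite hornerZ horner_prod (bigD1 i) 1?eq_sym //=.
by rewrite hornerXsubC subrr mul0r mulr0.
Qed.

Lemma interpolation (k : fieldType) n (t v : 'I_n -> k) : injective t ->
  exists2 q : {poly k}, (size q <= n)%N & forall i, q.[t i] = v i.
Proof.
move=> t_inj; pose D i := \prod_(j | j != i) (t i - t j).
have D0 i : D i != 0.
  by apply/prodf_neq0 => j ji; rewrite subr_eq0 (inj_eq t_inj) eq_sym.
exists (\sum_i (v i / D i) *: node_poly t i) => [|i].
  apply: leq_trans (size_sum _ _ _) _; apply/bigmax_leqP => i _.
  by rewrite (leq_trans (size_scale_leq _ _)) ?size_node_poly.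
by rewrite horner_sum_node_poly divfK.
Qed.

Lemma poly_first_order (k : fieldType) (p : {poly k}) a b :
  p.[0] = a -> p^`().[0] = b -> exists r, p = a%:P + 'X * (b%:P + 'X * r).
Proof.
rewrite !horner_coef0 coef_deriv => <- <-.
exists (\poly_(i < size p) p`_i.+2); apply/polyP => -[|[|i]].
all: rewrite coefD coefC coefXM /= ?addr0 ?add0r // coefD coefC coefXM /= ?addr0 ?add0r //.
rewrite coef_poly; case: ltnP => // ip.
by rewrite nth_default // (leq_trans ip) // ltnW.
Qed.

(** The equation [f] on the matrices [N *m g], as a polynomial in the entries of
[N]. *)
Definition restrict_factor (k : closedFieldType) d e n (f : coord_ring k d n)
    (g : 'M[k]_(e, d.+1)) : {mpoly k[n * e]} :=
  f \mPo [tuple mxvec ((\matrix_(i < n, j < e) 'X_(mxvec_index i j)) *m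
                       map_mx (@mpolyC _ k) g) 0 l | l < n * d.+1].

Lemma restrict_factorE (k : closedFieldType) d e n (f : coord_ring k d n)
    (g : 'M[k]_(e, d.+1)) v :
  (restrict_factor f g).@[v] = eval_rows f (vec_mx (\row_l v l) *m g).
Proof.
rewrite comp_mpoly_meval; apply: meval_eq => l.
rewrite tnth_mktuple; case/mxvec_indexP: l => i j; rewrite !mxvecE !mxE raddf_sum /=.
by apply: eq_bigr => m _; rewrite !mxE mevalM mevalC mevalXU.
Qed.

Lemma vanish_restrict_factor (k : closedFieldType) d e n (f : coord_ring k d n)
    (g : 'M[k]_(e, d.+1)) (N : 'M[k]_(n, e)) :
  restrict_factor f g = 0 -> eval_rows f (N *m g) = 0.
Proof.
move=> f0; have := meval0 (mxvec N 0); rewrite -f0 restrict_factorE.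
congr (eval_rows f (_ *m _) = 0); rewrite -[RHS]mxvecK; congr vec_mx.
by apply/rowP => l; rewrite mxE.
Qed.

(** Points moving with parameters [T i] on a curve that moves with velocity [H]. *)
Lemma rnc_mx_curve (k : fieldType) n d e (C T : 'I_n -> {poly k})
    (F H : 'I_e -> {poly k}) :
    (forall j, size (F j) <= d.+1)%N -> (forall j, size (H j) <= d.+1)%N ->
  rnc_mx C (fun=> 1) T (\matrix_(l < d.+1, j < e) (((F j)`_l)%:P + 'X * ((H j)`_l)%:P)) =
  \matrix_(i, j) (C i * (F j \Po T i + 'X * (H j \Po T i))).
Proof.
have compE (p q : {poly k}) : (size p <= d.+1)%N ->
    p \Po q = \sum_(l < d.+1) (p`_l)%:P * q ^+ l.
  move=> sp; rewrite comp_polyE (big_ord_widen _ (fun l => p`_l *: q ^+ l) sp).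
  rewrite big_mkcond; apply: eq_bigr => l _; rewrite mul_polyC.
  by case: ltnP => // pl; rewrite nth_default ?scale0r.
move=> sF sH; apply/matrixP => i j; rewrite !mxE !compE //; congr (_ * _).
rewrite mulr_sumr -big_split /=; apply: eq_bigr => l _.
by rewrite mxE expr1n mul1r; ring.
Qed.

(** The conormal vector of the curve [F = (t, t^2, 1 + t^3)] is
[F x F' = (t^4 - 2 t, 1 - 2 t^3, t^2)]. Displacements of a point modulo the
tangent space of the cone over [F] are measured by pairing with it. Pairing it
with the cubic vector polynomials [H] gives all the polynomials of degree at most
7, so the displacement of 8 points modulo tangent vectors can be interpolated;
the tangent part is obtained by moving and rescaling the points. *)
Lemma vanish_rank3 (k : closedFieldType) n (f : coord_ring k 3 n)
    (N : 'M[k]_(n, 3)) (g : 'M[k]_(3, 4)) :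
  (n <= 8)%N -> multihomog f -> vanishes_on_U f -> eval_rows f (N *m g) = 0.
Proof.
move=> n8 hf Uf.
apply: vanish_restrict_factor.
have [t t_inj t0] := exists_distinct k n.
pose F (j : 'I_3) : {poly k} := nth 0 [:: 'X; 'X^2; 1 + 'X^3] j.
have sF j : (size (F j) <= 4)%N.
  case: j => [[|[|[|//]]] j3]; rewrite /F /= ?size_polyX ?size_polyXn //.
  by rewrite (leq_trans (size_polyD _ _)) // size_poly1 size_polyXn.
apply: (@mpoly_first_order _ _ _ (fun l => mxvec (\matrix_(i, j) (F j).[t i]) 0 l)) => y.
pose Y i j := y (mxvec_index i j) : k.
pose o0 : 'I_3 := inord 0; pose o1 : 'I_3 := inord 1; pose o2 : 'I_3 := inord 2.
have [q sq qE] := interpolation (fun i => (t i ^+ 4 - 2%:R * t i) * Y i o0 +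
  (1 - 2%:R * t i ^+ 3) * Y i o1 + t i ^+ 2 * Y i o2) t_inj.
(* The [H] whose pairing with [F x F'] is [q], found by comparing coefficients. *)
pose cubic (c : seq k) := \poly_(l < 4) c`_l.
pose H (j : 'I_3) := nth 0
  [:: cubic [:: 0; 0; q`_6; q`_7]; cubic [:: q`_0; q`_1];
      cubic [:: q`_2; q`_3 + 2%:R * q`_0 + 2%:R * q`_6;
                q`_4 + 2%:R * q`_1 + 2%:R * q`_7; q`_5]] j.
have sH j : (size (H j) <= 4)%N.
  by case: j => [[|[|[|//]]] j3]; apply: size_poly.
pose z i j := Y i j - (H j).[t i].
have z_tangent i : (t i ^+ 4 - 2%:R * t i) * z i o0 +
    (1 - 2%:R * t i ^+ 3) * z i o1 + t i ^+ 2 * z i o2 = 0.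
  have HE : (t i ^+ 4 - 2%:R * t i) * (H o0).[t i] +
      (1 - 2%:R * t i ^+ 3) * (H o1).[t i] + t i ^+ 2 * (H o2).[t i] = q.[t i].
    rewrite (horner_coef_wide _ (leq_trans sq n8)) /H /o0 /o1 /o2 !inordK //= !horner_poly.
    by rewrite !big_ord_recl !big_ord0 /= /bump /=; ring.
  by rewrite /z -[RHS](subrr q.[t i]) {1}qE -HE; ring.
(* Near [t = 0] other coordinates would be needed; the [t i] are nonzero. *)
pose gam i := (2%:R * t i * z i o0 - z i o1) / t i ^+ 2.
pose tht i := z i o0 - gam i * t i.
have tangent i j : gam i * (F j).[t i] + tht i * (F j)^`().[t i] + (H j).[t i] = Y i j.
  rewrite -[Y i j](subrK (H j).[t i]) -/(z i j); congr (_ + _).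
  have := z_tangent i; have := t0 i; rewrite /tht /gam.
  have jE : [|| j == o0, j == o1 | j == o2].
    by rewrite -!val_eqE /= !inordK //; case: (j) => [[|[|[|]]]].
  move: (z i) => zi; move: (t i) => ti ti0 E.
  case/or3P: jE => /eqP ->; rewrite /F /o0 /o1 /o2 inordK //= -/o0 -/o1 -/o2.
  - by rewrite derivX hornerX hornerC; field.
  - by rewrite !derivE !hornerE /=; field.
  - have -> : zi o2 = - ((ti ^+ 4 - 2%:R * ti) * zi o0 +
        (1 - 2%:R * ti ^+ 3) * zi o1) / ti ^+ 2.
      apply: (mulfI (expf_neq0 2 ti0)); apply/eqP; rewrite -subr_eq0 -E.
      by apply/eqP; field.
    by rewrite !derivE !hornerE /=; field.
pose C i := 1 + (gam i)%:P * 'X; pose T i := (t i)%:P + (tht i)%:P * 'X.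
pose Gx := \matrix_(l < 4, j < 3) (((F j)`_l)%:P + 'X * ((H j)`_l)%:P).
have T00 i : (T i).[0] = t i by rewrite /T !hornerE.
have entry i j : exists r, C i * (F j \Po T i + 'X * (H j \Po T i)) =
    ((F j).[t i])%:P + 'X * ((Y i j)%:P + 'X * r).
  apply: poly_first_order.
    by rewrite /C !hornerE !horner_comp T00.
  rewrite -tangent derivM !derivE !deriv_comp /C /T !derivE.
  rewrite !hornerE !horner_comp !hornerE /=; ring.
have [r rE] := fin_all_exists (fun i => fin_all_exists (entry i)).
exists (fun l => mxvec (\matrix_(i, j) r i j) 0 l).
apply: (@poly_eq0_dense _ _ 1 (oner_neq0 _)) => x _.
rewrite horner_mmap restrict_factorE -(vanish_rnc (fun i => (C i).[x]) (fun=> 1)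
  (fun i => (T i).[x]) (map_mx (horner_eval x) Gx *m g) isT hf Uf).
rewrite -rnc_mxM; congr (eval_rows f (_ *m g)).
transitivity (map_mx (horner_eval x) (rnc_mx C (fun=> 1) T Gx)); last first.
  rewrite map_rnc_mx; apply/matrixP => i j; rewrite !mxE; congr (_ * _).
  by apply: eq_bigr => l _; rewrite /= /horner_eval hornerC.
rewrite (rnc_mx_curve _ _ sF sH); apply/matrixP => i j; rewrite !mxE rE.
by rewrite !mxvecE !mxE.
Qed.

(** * Duality of generalized Reed-Solomon codes *)

(** The values [N i j * c i] interpolate, up to the factors
[prod_(j != i) (t_i - t_j)], the polynomial [Q 0]. Each of the [m] vanishing
moments says that passing from [Q a] to [Q a.+1] is multiplication by ['X]. As
[Q m] has degree less than [n], the degree of [Q 0] is less than [n - m]. *)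
Lemma grs_dual (k : fieldType) d m n e (c t : 'I_n -> k) (N : 'M[k]_(n, e)) :
    n = (d.+1 + m)%N -> injective t -> (forall i, c i != 0) ->
    (forall a j, (a < m)%N -> \sum_i c i * t i ^+ a * N i j = 0) ->
  exists c' (G : 'M[k]_(d.+1, e)), N = rnc_mx c' (fun=> 1) t G.
Proof.
move=> nE t_inj c0 cN.
pose D i := \prod_(j | j != i) (t i - t j).
have D0 i : D i != 0.
  by apply/prodf_neq0 => j ji; rewrite subr_eq0 (inj_eq t_inj) eq_sym.
pose Q a j := \sum_i (N i j * c i * t i ^+ a) *: node_poly t i.
have QS a j : (a < m)%N -> Q a.+1 j = 'X * Q a j.
  move=> am; apply/esym/eqP; rewrite -subr_eq0 /Q mulr_sumr -sumrB.
  have -> : \sum_i ('X * ((N i j * c i * t i ^+ a) *: node_poly t i) -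
      (N i j * c i * t i ^+ a.+1) *: node_poly t i) =
      (\sum_i c i * t i ^+ a * N i j) *: \prod_i ('X - (t i)%:P).
    rewrite scaler_suml; apply: eq_bigr => i _.
    rewrite [in RHS](bigD1 i) //= -/(node_poly t i) exprS -!mul_polyC !rmorphM /=; ring.
  by rewrite cN // scale0r.
have QX a j : (a <= m)%N -> Q a j = 'X^a * Q 0%N j.
  elim: a => [|a IH] am; first by rewrite mul1r.
  by rewrite QS // IH ?(ltnW am) // exprS mulrA.
have sQ j : (size (Q 0%N j) <= d.+1)%N.
  have [->|Q0] := eqVneq (Q 0%N j) 0; first by rewrite size_poly0.
  rewrite -(leq_add2l m) -size_mulXn // mulrC -QX // addnC -nE.
  apply: leq_trans (size_sum _ _ _) _; apply/bigmax_leqP => i _.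
  by rewrite (leq_trans (size_scale_leq _ _)) ?size_node_poly.
exists (fun i => (c i * D i)^-1), (\matrix_(l, j) (Q 0%N j)`_l).
apply/matrixP => i j; rewrite mxE.
have -> : \sum_(l < d.+1) 1 ^+ (d - l) * t i ^+ l *
    (\matrix_(l < d.+1, j < e) (Q 0%N j)`_l) l j = (Q 0%N j).[t i].
  rewrite (horner_coef_wide _ (sQ j)); apply: eq_bigr => l _.
  by rewrite mxE expr1n mul1r mulrC.
rewrite horner_sum_node_poly -/(D i) expr0 mulr1; field.
by rewrite D0 c0.
Qed.

(** For generic [s] and [u] this is [grs_dual]. In general [s] and [u] are joined
by lines to generic ones; as the code spanned by the columns of [rnc_mx] has
full dimension at the start, [N] can be corrected along the line so as to stay in
the orthogonal space. *)
Lemma vanish_dual (k : closedFieldType) d m n e (f : coord_ring k d n)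
    (s u : 'I_n -> k) (N : 'M[k]_(n, e)) (g : 'M[k]_(e, d.+1)) :
    n = (d.+1 + m.+1)%N -> (0 < d)%N -> multihomog f -> vanishes_on_U f ->
    row_free (rnc_mx (fun=> 1) s u (1%:M : 'M[k]_m.+1))^T ->
    (rnc_mx (fun=> 1) s u (1%:M : 'M[k]_m.+1))^T *m N = 0 ->
  eval_rows f (N *m g) = 0.
Proof.
move=> nE d0 hf Uf; set H := rnc_mx _ _ _ _ => /row_freeP[R HR] HN.
have [tau tau_inj _] := exists_distinct k n.
pose S i := segment (s i) 1; pose U i := segment (u i) (tau i).
pose C p q (M : 'M[k]_(p, q)) := map_mx (@polyC k) M.
have CE p q (M : 'M[k]_(p, q)) x : map_mx (horner_eval x) (C _ _ M) = M.
  by apply/matrixP => i j; rewrite !mxE /horner_eval hornerC.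
pose Hx := rnc_mx (fun=> 1) S U (1%:M : 'M[{poly k}]_m.+1).
pose Kx := Hx^T *m C _ _ R.
(* The projection of [N] to the orthogonal space, cleared of denominators. *)
pose Nx := \det Kx *: C _ _ N - C _ _ R *m (\adj Kx *m (Hx^T *m C _ _ N)).
have HNx : Hx^T *m Nx = 0.
  rewrite mulmxBr -scalemxAr mulmxA -/Kx mulmxA mul_mx_adj.
  by rewrite mul_scalar_mx subrr.
have HxE x : map_mx (horner_eval x) Hx =
    rnc_mx (fun=> 1) (fun i => (S i).[x]) (fun i => (U i).[x]) 1%:M.
  rewrite map_rnc_mx map_scalar_mx /= /horner_eval hornerC.
  by apply/matrixP => i j; rewrite !mxE /= /horner_eval hornerC.
have Hx0 : map_mx (horner_eval 0) Hx = H.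
  rewrite HxE; apply/matrixP => i j; rewrite !mxE; congr (_ * _).
  by apply: eq_bigr => l _; rewrite !segment0.
have detK0 : horner_eval 0 (\det Kx) = 1.
  by rewrite -det_map_mx map_mxM -map_trmx Hx0 CE HR det1.
have Nx0 : map_mx (horner_eval 0) Nx = N.
  rewrite map_mxB map_mxZ !map_mxM /= !CE -map_trmx Hx0 HN !mulmx0 subr0.
  by rewrite detK0 scale1r.
suff /(congr1 (horner^~ 0)) : eval_curve f (Nx *m C _ _ g) = 0.
  by rewrite horner0 horner_eval_curve map_mxM Nx0 CE.
pose p := \prod_i S i * \prod_i \prod_(j | i != j) (S i * U j - S j * U i).
have pE x : p.[x] = \prod_i (S i).[x] *
    \prod_i \prod_(j | i != j) ((S i).[x] * (U j).[x] - (S j).[x] * (U i).[x]).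
  rewrite !hornerM !horner_prod; congr (_ * _).
  apply: eq_bigr => i _; rewrite horner_prod; apply: eq_bigr => j _.
  by rewrite hornerD hornerN !hornerM.
apply: (@eval_rows_along _ _ _ _ _ p).
  apply: contraTneq isT => /(congr1 (horner^~ 1)) /eqP; rewrite pE horner0.
  rewrite mulf_eq0 => /orP[/prodf_eq0[i _]|/prodf_eq0[i _ /prodf_eq0[j ij]]].
    by rewrite !segment1 oner_eq0.
  by rewrite !segment1 !mul1r subr_eq0 => /eqP/tau_inj ji; rewrite ji eqxx in ij.
move=> x; rewrite pE !mulf_eq0 !negb_or => /andP[/prodf_neq0 S0 /prodf_neq0 SU0].
rewrite map_mxM CE; set M := map_mx _ Nx.
have HM : (map_mx (horner_eval x) Hx)^T *m M = 0.
  by rewrite map_trmx -map_mxM HNx map_mx0.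
have [||a j am|c' [G ->]] := @grs_dual k d m.+1 n e (fun i => (S i).[x] ^+ m)
  (fun i => (U i).[x] / (S i).[x]) M nE.
- move=> i j tij; apply/eqP/negPn/negP => ij.
  move/prodf_neq0/(_ j ij): (SU0 i isT); case/negP.
  rewrite subr_eq0 mulrC -[_ * (U i).[x]]mulrC -eqr_div ?S0 //.
  by rewrite tij.
- by move=> i; rewrite expf_neq0 // S0.
- move/matrixP/(_ (Ordinal am) j): HM; rewrite HxE !mxE => HMa.
  rewrite -[RHS]HMa; apply: eq_bigr => i _; rewrite !mxE; congr (_ * _).
  rewrite (bigD1 (Ordinal am)) //= big1 ?addr0 => [|l la]; rewrite !mxE.
    rewrite eqxx mulr1 mul1r expr_div_n -{1}(subnK (am : (a <= m)%N)) exprD.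
    by rewrite -mulrA [X in _ * X]mulrCA divff ?expf_neq0 ?S0 // mulr1.
  by rewrite (negPf la) mulr0.
by rewrite rnc_mxM vanish_rnc.
Qed.

(** * Quadric cones through eight points *)
(** The discriminant of the quaternary form with coefficients [a], see
[square_free_form]. In terms of the products [A, B, C] of the coefficients of
complementary pairs of variables, it is the symmetric expression
[A^2 + B^2 + C^2 - 2AB - 2AC - 2BC]. *)
Definition pencil_disc (R : comNzRingType) (a : 'I_6 -> R) : R :=
  let b i := a (inord i) in
  (b 0%N * b 5%N + b 1%N * b 4%N - b 2%N * b 3%N) ^+ 2 -
  4%:R * (b 0%N * b 5%N) * (b 1%N * b 4%N).

Lemma pencil_discZ (R : comNzRingType) (a : 'I_6 -> R) c :
  pencil_disc (fun i => c * a i) = c ^+ 4 * pencil_disc a.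
Proof. by rewrite /pencil_disc; ring. Qed.

Lemma horner_pencil_disc (k : fieldType) (a : 'I_6 -> {poly k}) x :
  (pencil_disc a).[x] = pencil_disc (fun i => (a i).[x]).
Proof.
rewrite -[LHS]/(horner_eval x _) /pencil_disc.
by rewrite !(rmorph_nat, rmorphB, rmorphXn, rmorphD, rmorphM).
Qed.

(** If the discriminant of [a + 'X * a'] is a constant [c], then by homogeneity that
of ['X * a + a'] is [c 'X^4], so [a'] is a zero. *)
Lemma pencil_disc_root (k : closedFieldType) (a a' : 'I_6 -> k) :
  exists l m, (l, m) != (0, 0) /\ pencil_disc (fun i => l * a i + m * a' i) = 0.
Proof.
pose p := pencil_disc (fun i => (a i)%:P + 'X * (a' i)%:P).
have pE x : p.[x] = pencil_disc (fun i => a i + x * a' i).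
  by rewrite horner_pencil_disc /pencil_disc !hornerE.
have [/size_poly1P[c _ pc]|sp] := boolP (size p == 1%N); last first.
  have [x /eqP px] := closed_rootP _ sp.
  exists 1, x; split; first by rewrite xpair_eqE oner_eq0.
  by rewrite -[RHS]px pE /pencil_disc; ring.
exists 0, 1; split; first by rewrite xpair_eqE oner_eq0 andbF.
pose r := pencil_disc (fun i => 'X * (a i)%:P + (a' i)%:P).
have rE x : r.[x] = pencil_disc (fun i => x * a i + a' i).
  by rewrite horner_pencil_disc /pencil_disc !hornerE.
have : r - c *: 'X^4 = 0.
  apply: poly_eq0_dense (monic_neq0 (monicX k)) _ => x; rewrite hornerX => x0.
  rewrite hornerD hornerN hornerZ hornerXn rE.
  have -> : c = pencil_disc (fun i => a i + x^-1 * a' i) by rewrite -pE pc hornerC.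
  rewrite mulrC -pencil_discZ; apply/eqP; rewrite subr_eq0; apply/eqP.
  by rewrite /pencil_disc; field.
move/(congr1 (horner^~ 0)); rewrite hornerD hornerN hornerZ hornerXn rE horner0.
by rewrite expr0n mulr0 subr0 => disc0; rewrite -[RHS]disc0 /pencil_disc; ring.
Qed.

(** Quadrics through the four coordinate points have no square terms. The pairs of
variables are in lexicographic order. *)
Definition square_free_form (R : comNzRingType) (a : 'I_6 -> R) (x : 'cV[R]_4) : R :=
  let b i := a (inord i) in let y i := x (inord i) 0 in
  b 0%N * (y 0%N * y 1%N) + b 1%N * (y 0%N * y 2%N) + b 2%N * (y 0%N * y 3%N) +
  b 3%N * (y 1%N * y 2%N) + b 4%N * (y 1%N * y 3%N) + b 5%N * (y 2%N * y 3%N).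

(** Multiplying the form by [a3] and splitting off the product of the linear forms
[a1 x0 + a3 x1 + a5 x3] and [a0 x0 + a3 x2 + a4 x3] leaves a binary form in
[x0, x3], whose discriminant is [pencil_disc a]. When that is 0, this binary form
is the square of [r x0 + s x3], even in characteristic 2. *)
Lemma complete_square (k : closedFieldType) (a : 'I_6 -> k) :
    pencil_disc a = 0 -> a (inord 3) != 0 -> a (inord 0) != 0 -> a (inord 1) != 0 ->
  exists2 L : 'M[k]_(3, 4), row_free L & forall x,
    (L *m x) ord0 0 * (L *m x) ord_max 0 - (L *m x) (inord 1) 0 ^+ 2 =
    a (inord 3) * square_free_form a x.
Proof.
rewrite /pencil_disc /square_free_form.
move: (a (inord 0)) (a (inord 1)) (a (inord 2)) (a (inord 3)) (a (inord 4)) (a (inord 5)).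
move=> a0 a1 a2 a3 a4 a5 disc0 a3n a0n a1n.
have [r rE] := exists_sqrt (a0 * a1); have [s0 s0E] := exists_sqrt (a4 * a5).
have [s sE rsE] : exists2 s, s ^+ 2 = a4 * a5 & 2%:R * (r * s) = a0 * a5 + a1 * a4 - a2 * a3.
  have : (2%:R * (r * s0)) ^+ 2 == (a0 * a5 + a1 * a4 - a2 * a3) ^+ 2.
    rewrite eq_sym -subr_eq0 !exprMn rE s0E -[X in _ == X]disc0; apply/eqP; ring.
  rewrite eqf_sqr => /orP[] /eqP E; first by exists s0.
  by exists (- s0); [rewrite sqrrN | rewrite !mulrN E opprK].
pose Lseq := [:: [:: a1; a3; 0; a5]; [:: r; 0; 0; s]; [:: a0; 0; a3; a4]].
pose L : 'M[k]_(3, 4) := \matrix_(i, j) (nth [::] Lseq i)`_j.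
have r0 : r != 0.
  by apply: contraNneq (mulf_neq0 a0n a1n) => r0; rewrite -rE r0 expr0n.
exists L => [|x].
  rewrite -kermx_eq0; apply/rowV0P => v /sub_kermxP/rowP vL.
  have v1 : v 0 ord0 = 0.
    have := vL (inord 1); rewrite !mxE !big_ord_recl big_ord0 !mxE /= !inordK //=.
    by rewrite !mulr0 !addr0 => /eqP; rewrite mulf_eq0 (negPf a3n) orbF => /eqP.
  have v3 : v 0 ord_max = 0.
    have := vL (inord 2); rewrite !mxE !big_ord_recl big_ord0 !mxE /= !inordK //=.
    rewrite !mulr0 !add0r addr0 => /eqP; rewrite mulf_eq0 (negPf a3n) orbF => /eqP <-.
    by congr (v 0 _); apply: val_inj.
  have v2 : v 0 (inord 1) = 0.
    have := vL ord0; rewrite !mxE !big_ord_recl big_ord0 !mxE /=.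
    rewrite v1 (_ : lift ord0 (lift ord0 ord0) = ord_max) ?v3; last exact: val_inj.
    rewrite !mul0r add0r !addr0 => /eqP; rewrite mulf_eq0 (negPf r0) orbF => /eqP <-.
    by congr (v 0 _); apply: val_inj; rewrite /= inordK.
  apply/rowP => i; rewrite mxE.
  have : [|| i == ord0, i == inord 1 | i == ord_max].
    by rewrite -!val_eqE /= inordK //; case: i => [[|[|[|]]]].
  by case/or3P => /eqP ->.
have LE i : (L *m x) i 0 = \sum_(j < 4) (nth [::] Lseq i)`_j * x (inord j) 0.
  by rewrite mxE; apply: eq_bigr => j _; rewrite mxE inord_val.
rewrite !LE inordK //= !big_ord_recl !big_ord0 /= /bump /= !addn0 ?add1n.
move: (x (inord 0) 0) (x (inord 1) 0) (x (inord 2) 0) (x (inord 3) 0) => x0 x1 x2 x3.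
transitivity ((a1 * x0 + a3 * x1 + a5 * x3) * (a0 * x0 + a3 * x2 + a4 * x3) -
  (r ^+ 2 * x0 ^+ 2 + 2%:R * (r * s) * (x0 * x3) + s ^+ 2 * x3 ^+ 2)); first by ring.
by rewrite rE rsE sE; ring.
Qed.

(** The rows from 1 on are the values at four points of the monomials of a form
without squares in which the product of the variables [xi] and [xj] is missing.
Row 0 is kept free in order to express kernels by cofactors. *)
Definition quad_mx (R : comNzRingType) (xi xj xk xl : 'I_4 -> R) (w : 'I_5 -> R) : 'M[R]_5 :=
  \matrix_(r, c) if unlift ord0 r is Some p then
    [:: xi p * xk p; xi p * xl p; xj p * xk p; xj p * xl p; xk p * xl p]`_c
  else w c.

Definition quad_minor (R : comNzRingType) (xi xj xk xl : 'I_4 -> R) (c : 'I_5) : R :=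
  cofactor (quad_mx xi xj xk xl (fun=> 0)) ord0 c.

(** If the missing coefficient is 0, then the discriminant is the square of
[a_ik a_jl - a_il a_jk]. The inequality [quad_generic != 0] says that the form
through the four points with missing coefficient 0 does not satisfy this; so in
the pencil, a singular quadric has a nonzero coefficient there. *)
Definition quad_generic (R : comNzRingType) (xi xj xk xl : 'I_4 -> R) : R :=
  let v i := quad_minor xi xj xk xl (inord i) in v 0%N * v 3%N - v 1%N * v 2%N.

Lemma quad_generic_map (R S : comNzRingType) (phi : {rmorphism R -> S})
    (xi xj xk xl : 'I_4 -> R) :
  phi (quad_generic xi xj xk xl) =
  quad_generic (phi \o xi) (phi \o xj) (phi \o xk) (phi \o xl).
Proof.
have minorE c : phi (quad_minor xi xj xk xl c) =
    quad_minor (phi \o xi) (phi \o xj) (phi \o xk) (phi \o xl) c.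
  rewrite /quad_minor -cofactor_map_mx; congr (cofactor _ _ _).
  apply/matrixP => r c'; rewrite !mxE; case: unliftP => [p _|_]; last exact: rmorph0.
  by case: c' => [[|[|[|[|[|//]]]]] c5] /=; rewrite rmorphM.
by rewrite /quad_generic rmorphB [X in X - _]rmorphM [X in _ - X]rmorphM !minorE.
Qed.

Lemma cofactor_quad_mx (R : comNzRingType) (xi xj xk xl : 'I_4 -> R) w c :
  cofactor (quad_mx xi xj xk xl w) ord0 c = quad_minor xi xj xk xl c.
Proof.
congr (_ * \det _); apply/matrixP => r c'; rewrite !mxE.
by rewrite liftK.
Qed.

(** Cramer's rule: a kernel vector of the rows 1 to 4 is proportional to the vector
of their maximal minors. *)
Lemma quad_minor_kernel (k : fieldType) (xi xj xk xl : 'I_4 -> k) (a : 'cV[k]_5) w :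
    (forall p, (quad_mx xi xj xk xl w *m a) (lift ord0 p) 0 = 0) ->
  forall c, (\sum_l w l * quad_minor xi xj xk xl l) * a c 0 =
    quad_minor xi xj xk xl c * (\sum_l w l * a l 0).
Proof.
move=> Ta c; pose T := quad_mx xi xj xk xl w.
have detT : \det T = \sum_l w l * quad_minor xi xj xk xl l.
  rewrite (expand_det_row _ ord0); apply: eq_bigr => l _.
  by rewrite cofactor_quad_mx mxE unlift_none.
have := congr1 (fun M : 'cV_5 => M c 0) (mulmxA (\adj T) T a).
rewrite mul_adj_mx mul_scalar_mx [RHS]mxE detT => <-.
rewrite mxE (bigD1 ord0) //= big1 ?addr0 => [|r r0].
  rewrite mxE cofactor_quad_mx; congr (_ * _); rewrite mxE.
  by apply: eq_bigr => l _; rewrite mxE unlift_none.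
have [p ->] : exists p, r = lift ord0 p.
  by case: (unliftP ord0 r) r0 => [p ->|->]; [exists p | rewrite eqxx].
by rewrite Ta mulr0.
Qed.

Lemma quad_generic_kernel (k : fieldType) (xi xj xk xl : 'I_4 -> k) (a0 a1 a2 a3 a4 : k) :
    quad_generic xi xj xk xl != 0 ->
    (forall p, a0 * (xi p * xk p) + a1 * (xi p * xl p) + a2 * (xj p * xk p) +
      a3 * (xj p * xl p) + a4 * (xk p * xl p) = 0) ->
    a0 * a3 = a1 * a2 ->
  [/\ a0 = 0, a1 = 0, a2 = 0, a3 = 0 & a4 = 0].
Proof.
move=> gen0 aP a03; pose a (c : 'I_5) := [:: a0; a1; a2; a3; a4]`_c.
suff a_0 c : a c = 0.
  by split; [have := a_0 (inord 0) | have := a_0 (inord 1) | have := a_0 (inord 2)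
    | have := a_0 (inord 3) | have := a_0 (inord 4)]; rewrite /a inordK.
apply/eqP/negPn/negP => ac; case/negP: gen0.
have mE w : forall p, (quad_mx xi xj xk xl w *m (\col_l a l)) (lift ord0 p) 0 = 0.
  move=> p; rewrite mxE -[RHS](aP p).
  rewrite !big_ord_recl big_ord0 /= !mxE !liftK /a /= /bump /=; ring.
have va l : quad_minor xi xj xk xl l * a c = quad_minor xi xj xk xl c * a l.
  have := quad_minor_kernel (mE (fun l' => (l' == l)%:R)) c.
  have delta (h : 'I_5 -> k) : \sum_l' (l' == l)%:R * h l' = h l.
    rewrite (bigD1 l) //= eqxx mul1r big1 ?addr0 // => l' /negPf ->.
    by rewrite mul0r.
  by rewrite delta mxE (delta (fun l' => (\col_l a l) l' 0)) mxE.
have : quad_generic xi xj xk xl * a c ^+ 2 == 0.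
  rewrite /quad_generic; set v := quad_minor xi xj xk xl.
  transitivity (((v (inord 0) * a c) * (v (inord 3) * a c) -
     (v (inord 1) * a c) * (v (inord 2) * a c)) == 0); first by congr (_ == 0); ring.
  rewrite !va -/v; apply/eqP.
  transitivity (v c ^+ 2 * (a (inord 0) * a (inord 3) - a (inord 1) * a (inord 2))); first by ring.
  by rewrite /a !inordK //= a03 subrr mulr0.
by rewrite mulf_eq0 expf_eq0 (negPf ac) orbF.
Qed.

Lemma eq_quad_generic (R : comNzRingType) (xi xj xk xl yi yj yk yl : 'I_4 -> R) :
  xi =1 yi -> xj =1 yj -> xk =1 yk -> xl =1 yl ->
  quad_generic xi xj xk xl = quad_generic yi yj yk yl.
Proof.
move=> Ei Ej Ek El; rewrite /quad_generic /quad_minor.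
suff -> : quad_mx xi xj xk xl (fun=> 0) = quad_mx yi yj yk yl (fun=> 0) by [].
by apply/matrixP => r c; rewrite !mxE; case: unlift => // p; rewrite Ei Ej Ek El.
Qed.

(** The four points are [e_i + e_l], [e_j + e_k], [e_k + e_l] and
[e_i + e_j + e_k - e_l]. In every characteristic, [x_i x_k + x_j x_l] is the only
form through them without [x_i x_j]. *)
Lemma quad_generic_example (k : fieldType) :
  quad_generic (fun p => [:: 1; 0; 0; 1]`_p) (fun p => [:: 0; 1; 0; 1]`_p)
    (fun p => [:: 0; 1; 1; 1]`_p) (fun p => [:: 1; 0; 1; -1]`_p) != 0 :> k.
Proof.
set xi := (fun p => _); set xj := (fun p => _); set xk := (fun p => _); set xl := (fun p => _).
pose w l : k := (l == ord0 :> 'I_5)%:R.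
pose a : 'cV[k]_5 := \col_l [:: 1; 0; 0; 1; 0]`_l.
have aT p : (quad_mx xi xj xk xl w *m a) (lift ord0 p) 0 = 0.
  rewrite mxE !big_ord_recl big_ord0 !mxE !liftK /=.
  by case: p => [[|[|[|[|//]]]] p4]; rewrite /xi /xj /xk /xl /=; ring.
have delta (h : 'I_5 -> k) : \sum_l w l * h l = h ord0.
  rewrite (bigD1 ord0) //= big1 ?addr0 => [|l /negPf l0]; rewrite /w ?l0 ?mul0r //.
  by rewrite eqxx mul1r.
have vE c : quad_minor xi xj xk xl c = quad_minor xi xj xk xl ord0 * [:: 1; 0; 0; 1; 0]`_c.
  have := quad_minor_kernel aT c.
  by rewrite delta (delta (fun l => a l 0)) !mxE mulr1 => ->.
have v0 : quad_minor xi xj xk xl ord0 != 0.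
  have -> : quad_minor xi xj xk xl ord0 = \det (quad_mx xi xj xk xl w).
    rewrite (expand_det_row _ ord0) -[LHS]delta; apply: eq_bigr => l _.
    by rewrite cofactor_quad_mx mxE unlift_none.
  apply/det0P => -[v v0 /rowP vT]; case/eqP: v0.
  have col c : v 0 ord0 * w c + \sum_(p < 4) v 0 (lift ord0 p) *
     [:: xi p * xk p; xi p * xl p; xj p * xk p; xj p * xl p; xk p * xl p]`_c = 0.
    have := vT c; rewrite !mxE big_ord_recl mxE unlift_none => vTc; rewrite -[RHS]vTc.
    by congr (_ + _); apply: eq_bigr => p _; rewrite mxE liftK.
  have := col (inord 0); have := col (inord 1); have := col (inord 2).
  have := col (inord 3); have := col (inord 4).
  rewrite /w -!val_eqE /= !inordK //= !big_ord_recl !big_ord0 /= /xi /xj /xk /xl /=.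
  rewrite !(mulr0, mul0r, mulr1, mul1r, addr0, add0r, mulrN1, mulrN).
  move=> v4 v3; move/eqP: v3; rewrite oppr_eq0 => /eqP v3.
  rewrite v3 !(addr0, oppr0) in v4 *; rewrite ?subr0 => v2 v1 vv0.
  apply/rowP => c; rewrite mxE; case: (unliftP ord0 c) => [p ->|-> //].
  case: (unliftP ord0 p) => [p' ->|-> //]; case: (unliftP ord0 p') => [p'' ->|-> //].
  by case: (unliftP ord0 p'') => [q ->|-> //]; rewrite (ord1 q).
move: (quad_minor xi xj xk xl ord0) v0 vE => m0 m00 vE.
rewrite /quad_generic !vE !inordK //= !(mulr0, mulr1) subr0 mulf_neq0 //.
Qed.

Lemma exists_quad_generic (k : fieldType) (i j i' j' : 'I_4) : uniq [:: i; j; i'; j'] ->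
  exists B : 'M[k]_4, quad_generic (B i) (B j) (B i') (B j') != 0.
Proof.
rewrite /= !inE !negb_or andbT => /andP[/and3P[ij ii' ij'] /andP[/andP[ji' jj'] i'j']].
exists (\matrix_(r, p) (if r == i then [:: 1; 0; 0; 1]`_p else
  if r == j then [:: 0; 1; 0; 1]`_p else
  if r == i' then [:: 0; 1; 1; 1]`_p else [:: 1; 0; 1; -1]`_p)).
rewrite -(eq_quad_generic (xi := fun p => [:: 1; 0; 0; 1]`_p)
  (xj := fun p => [:: 0; 1; 0; 1]`_p) (xk := fun p => [:: 0; 1; 1; 1]`_p)
  (xl := fun p => [:: 1; 0; 1; -1]`_p)) ?quad_generic_example // => p; rewrite mxE.
- by rewrite eqxx.
- by rewrite eq_sym (negPf ij) eqxx.
- by rewrite eq_sym (negPf ii') eq_sym (negPf ji') eqxx.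
- by rewrite eq_sym (negPf ij') eq_sym (negPf jj') eq_sym (negPf i'j').
Qed.

(** Four points impose four conditions on six coefficients, which leaves a pencil. *)
Lemma exists_degenerate_quadric (k : closedFieldType) (B : 'M[k]_4) :
  exists a : 'I_6 -> k, [/\ exists c, a c != 0, pencil_disc a = 0 &
    forall p, square_free_form a (col p B) = 0].
Proof.
pose o i : 'I_4 := inord i.
pose E : 'M[k]_(6, 4) := \matrix_(c, p)
  [:: B (o 0%N) p * B (o 1%N) p; B (o 0%N) p * B (o 2%N) p; B (o 0%N) p * B (o 3%N) p;
      B (o 1%N) p * B (o 2%N) p; B (o 1%N) p * B (o 3%N) p; B (o 2%N) p * B (o 3%N) p]`_c.
pose W := row_base (kermx E).
have r2 : (2 <= \rank (kermx E))%N.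
  by rewrite mxrank_ker; have := rank_leq_col E; lia.
pose i0 := Ordinal (ltnW r2); pose i1 := Ordinal r2.
have [l [m [lm disc0]]] := pencil_disc_root (W i0) (W i1).
exists (fun i => l * W i0 i + m * W i1 i); split=> //.
  pose v : 'rV[k]_(\rank (kermx E)) := l *: delta_mx 0 i0 + m *: delta_mx 0 i1.
  have vE c : (v *m W) 0 c = l * W i0 c + m * W i1 c.
    by rewrite mulmxDl -!scalemxAl -!rowE !mxE.
  have v0 : v != 0.
    apply: contraNneq lm => /rowP v0; have := v0 i0; have := v0 i1; rewrite !mxE !eqxx /=.
    rewrite !(mulr0, mulr1, addr0, add0r) => m0 l0.
    by rewrite l0 m0.
  have /rV0Pn[c] : v *m W != 0.
    apply: contraNneq v0 => vW0; apply/eqP.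
    by apply: (row_free_inj (row_base_free (kermx E))); rewrite vW0 mul0mx.
  by rewrite vE; exists c.
move=> p; have /sub_kermxP/matrixP WE : (W <= kermx E)%MS by rewrite eq_row_base.
have WEr i : \sum_c W i c * E c p = 0 by have := WE i p; rewrite !mxE.
have : l * (\sum_c W i0 c * E c p) + m * (\sum_c W i1 c * E c p) = 0.
  by rewrite !WEr !mulr0 addr0.
move=> <-; rewrite /square_free_form.
have sumE i : \sum_c W i c * E c p = \sum_(c < 6) W i (inord c) * E (inord c) p.
  by apply: eq_bigr => c _; rewrite inord_val.
rewrite !sumE !big_ord_recl !big_ord0 /= /bump /= !addn0 ?add1n !mxE !inordK //=.
rewrite /o; ring.
Qed.

Lemma conic_param (k : closedFieldType) (x y z : k) : x * z = y ^+ 2 ->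
  exists s u, [/\ x = s ^+ 2, y = s * u & z = u ^+ 2].
Proof.
have [s <-] := exists_sqrt x; have [u <-] := exists_sqrt z; rewrite -exprMn => /eqP.
rewrite eqf_sqr => /orP[] /eqP E; first by exists s, u; rewrite E.
by exists s, (- u); rewrite sqrrN mulrN E opprK.
Qed.

(** The points are the columns of [B], and [i], [j] are the variables whose product
is missing. *)
Definition pair_generic (R : comNzRingType) (B : 'M[R]_4) (i j i' j' : nat) : R :=
  quad_generic (B (inord i)) (B (inord j)) (B (inord i')) (B (inord j')).

(** Three coefficients of the singular quadric must not vanish for
[complete_square] to apply; each of the hypotheses ensures one of them. *)
Lemma generic_cone (k : closedFieldType) (B : 'M[k]_4) :
    pair_generic B 1 2 0 3 != 0 -> pair_generic B 0 1 2 3 != 0 ->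
    pair_generic B 0 2 1 3 != 0 ->
  exists a (L : 'M[k]_(3, 4)), [/\ row_free L,
    forall p, square_free_form a (col p B) = 0 & forall x,
    (L *m x) ord0 0 * (L *m x) ord_max 0 - (L *m x) (inord 1) 0 ^+ 2 =
    a (inord 3) * square_free_form a x].
Proof.
move=> g1 g2 g3; pose o i : 'I_4 := inord i.
have [a [[c ac] disc0 aB]] := exists_degenerate_quadric B.
have aBp p : a (inord 0) * (B (o 0%N) p * B (o 1%N) p) + a (inord 1) * (B (o 0%N) p * B (o 2) p) +
    a (inord 2) * (B (o 0%N) p * B (o 3) p) + a (inord 3) * (B (o 1%N) p * B (o 2) p) +
    a (inord 4) * (B (o 1%N) p * B (o 3) p) + a (inord 5) * (B (o 2) p * B (o 3) p) = 0.
  by rewrite -[RHS](aB p) /square_free_form !mxE.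
move: (disc0); rewrite /pencil_disc => disc.
have all0 : a (inord 0) = 0 -> a (inord 1) = 0 -> a (inord 2) = 0 ->
    a (inord 3) = 0 -> a (inord 4) = 0 -> a (inord 5) = 0 -> False.
  move=> a0 a1 a2 a3 a4 a5; case/eqP: ac; rewrite -[c]inord_val.
  by case: (c) => [[|[|[|[|[|[|//]]]]]] c6].
have sqr0 (x y : k) : (x - y) ^+ 2 = 0 -> x = y.
  by move/eqP; rewrite expf_eq0 /= subr_eq0 => /eqP.
have a3n : a (inord 3) != 0.
  apply/eqP => a3.
  have [||a_0 a_4 a_1 a_5 a_2] := quad_generic_kernel (a0 := a (inord 0))
    (a1 := a (inord 4)) (a2 := a (inord 1)) (a3 := a (inord 5)) (a4 := a (inord 2)) g1.
  - by move=> p; rewrite -[RHS](aBp p) a3; ring.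
  - by apply: sqr0; rewrite -[RHS]disc a3; ring.
  - exact: all0.
have a0n : a (inord 0) != 0.
  apply/eqP => a0.
  have [||a_1 a_2 a_3 a_4 a_5] := quad_generic_kernel (a0 := a (inord 1))
    (a1 := a (inord 2)) (a2 := a (inord 3)) (a3 := a (inord 4)) (a4 := a (inord 5)) g2.
  - by move=> p; rewrite -[RHS](aBp p) a0; ring.
  - by apply: sqr0; rewrite -[RHS]disc a0; ring.
  - exact: all0.
have a1n : a (inord 1) != 0.
  apply/eqP => a1.
  have [||a_0 a_2 a_3 a_5 a_4] := quad_generic_kernel (a0 := a (inord 0))
    (a1 := a (inord 2)) (a2 := a (inord 3)) (a3 := a (inord 5)) (a4 := a (inord 4)) g3.
  - by move=> p; rewrite -[RHS](aBp p) a1; ring.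
  - by apply: sqr0; rewrite -[RHS]disc a1; ring.
  - exact: all0.
have [L Lfree LE] := complete_square disc0 a3n a0n a1n.
by exists a, L.
Qed.

(** The columns of the block matrix [(- dual_points M, det A)], where [A] is the
upper block of [M], are orthogonal to [M]: four of the dual points are multiples
of the coordinate points, the other four are the columns of [dual_points M] up to
sign. *)
Definition dual_points (R : comNzRingType) (M : 'M[R]_(4 + 4, 4)) : 'M[R]_4 :=
  dsubmx M *m \adj (usubmx M).

Lemma pair_generic_map (R S : comNzRingType) (phi : {rmorphism R -> S}) M i j i' j' :
  phi (pair_generic (dual_points M) i j i' j') =
  pair_generic (dual_points (map_mx phi M)) i j i' j'.
Proof.
rewrite /pair_generic quad_generic_map /dual_points -map_usubmx -map_dsubmx.
by rewrite -map_mx_adj -map_mxM; apply: eq_quad_generic => p; rewrite [RHS]mxE.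
Qed.

Definition cone_generic (R : comNzRingType) (M : 'M[R]_(4 + 4, 4)) : R :=
  \det (usubmx M) * (pair_generic (dual_points M) 1 2 0 3 *
  (pair_generic (dual_points M) 0 1 2 3 * pair_generic (dual_points M) 0 2 1 3)).

Lemma cone_generic_map (R S : comNzRingType) (phi : {rmorphism R -> S}) M :
  phi (cone_generic M) = cone_generic (map_mx phi M).
Proof.
rewrite /cone_generic rmorphM -det_map_mx map_usubmx; congr (_ * _).
rewrite rmorphM pair_generic_map; congr (_ * _).
by rewrite rmorphM !pair_generic_map.
Qed.

Lemma cone_generic_neq0 (k : closedFieldType) :
  cone_generic (\matrix_(i < 4 + 4, j < 4) 'X_(mxvec_index i j) :
    'M[{mpoly k[(4 + 4) * 4]}]_(4 + 4, 4)) != 0.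
Proof.
set NX := \matrix_(i, j) _.
have eval_at M : map_mx (meval (mxvec M 0)) NX = M.
  by apply/matrixP => i j; rewrite !mxE mevalXU mxvecE.
have gen0 i j i' j' : uniq [:: inord i : 'I_4; inord j; inord i'; inord j'] ->
    pair_generic (dual_points NX) i j i' j' != 0.
  move=> /(exists_quad_generic k)[B]; apply: contraNneq.
  move=> /(congr1 (meval (mxvec (col_mx 1%:M B) 0))).
  rewrite meval0 pair_generic_map eval_at /dual_points col_mxKu col_mxKd adj1 mulmx1.
  by move/eqP.
have gens0 : pair_generic (dual_points NX) 1 2 0 3 *
    (pair_generic (dual_points NX) 0 1 2 3 * pair_generic (dual_points NX) 0 2 1 3) != 0.
  by rewrite !mulf_neq0 ?gen0 //= !inE -!val_eqE /= !inordK.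
rewrite mulf_neq0 //; apply/eqP => /(congr1 (meval (mxvec (col_mx 1%:M 0) 0)))/eqP.
by rewrite meval0 -det_map_mx map_usubmx eval_at col_mxKu det1 oner_eq0.
Qed.

Lemma dual_on_conic (k : closedFieldType) (N : 'M[k]_(4 + 4, 4)) :
    cone_generic N != 0 ->
  exists s u : 'I_(4 + 4) -> k,
    row_free (rnc_mx (fun=> 1) s u (1%:M : 'M[k]_3))^T /\
    (rnc_mx (fun=> 1) s u (1%:M : 'M[k]_3))^T *m N = 0.
Proof.
rewrite /cone_generic !mulf_eq0 !negb_or => /andP[A0 /and3P[g1 g2 g3]].
have [a [L [Lfree aB LE]]] := generic_cone g1 g2 g3.
pose A := usubmx N; pose B := dual_points N.
pose KT : 'M[k]_(4, 4 + 4) := row_mx (- B) (\det A)%:M.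
have KN : KT *m N = 0.
  rewrite -[N]vsubmxK mul_row_col -/A mul_scalar_mx /B /dual_points.
  by rewrite mulNmx -mulmxA mul_adj_mx mul_mx_scalar addNr.
have sq0 c (x : 'cV[k]_4) : square_free_form a x = 0 -> square_free_form a (c *: x) = 0.
  move=> x0; rewrite -(mulr0 (c ^+ 2)) -x0 /square_free_form !mxE; ring.
have conic (i : 'I_(4 + 4)) : square_free_form a (col i KT) = 0.
  case: (split_ordP i) => j ->.
    have -> : col (lshift 4 j) KT = -1 *: col j B.
      by apply/colP => r; rewrite [LHS]mxE /KT row_mxEl !mxE mulN1r.
    exact: sq0.
  have -> : col (rshift 4 j) KT = \det A *: col j 1%:M.
    by apply/colP => r; rewrite [LHS]mxE /KT row_mxEr !mxE mulr_natr.
  apply: sq0; rewrite /square_free_form !mxE -!val_eqE /= !inordK //.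
  by case: j => [[|[|[|[|//]]]] j4] /=; ring.
have /fin_all_exists[su suE] (i : 'I_(4 + 4)) : exists su : k * k,
    [/\ (L *m KT) ord0 i = su.1 ^+ 2, (L *m KT) (inord 1) i = su.1 * su.2 &
        (L *m KT) ord_max i = su.2 ^+ 2].
  have colE r : (L *m KT) r i = (L *m col i KT) r 0.
    by rewrite colE mulmxA -colE [RHS]mxE.
  have [|s [u [xE yE zE]]] := @conic_param k ((L *m KT) ord0 i) ((L *m KT) (inord 1) i)
    ((L *m KT) ord_max i).
    by apply/eqP; rewrite -subr_eq0 !colE LE conic mulr0.
  by exists (s, u).
pose s (i : 'I_(4 + 4)) := (su i).1; pose u (i : 'I_(4 + 4)) := (su i).2.
have HE : (rnc_mx (fun=> 1) s u (1%:M : 'M[k]_3))^T = L *m KT.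
  apply/matrixP => r i; have [x_E y_E z_E] := suE i; rewrite [LHS]mxE [LHS]mxE mul1r.
  rewrite (bigD1 r) //= big1 ?addr0 => [|l lr]; last by rewrite mxE (negPf lr) mulr0.
  rewrite mxE eqxx mulr1.
  have : [|| r == ord0, r == inord 1 | r == ord_max].
    by rewrite -!val_eqE /= inordK //; case: (r) => [[|[|[|]]]].
  case/or3P => /eqP ->; rewrite ?x_E ?y_E ?z_E /s /u /= ?inordK //=; ring.
exists s, u; rewrite HE; split; last by rewrite -mulmxA KN mulmx0.
have /row_freeP[R1 LR] := Lfree.
apply/row_freeP; exists (col_mx 0 ((\det A)^-1%:M) *m R1).
rewrite mulmxA -[L *m KT *m _]mulmxA mul_row_col mulmx0 add0r.
by rewrite -scalar_mxM mulfV // mulmx1.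
Qed.

Lemma vanish_rank4 (k : closedFieldType) (f : coord_ring k 4 (4 + 4))
    (N : 'M[k]_(4 + 4, 4)) (g : 'M[k]_(4, 5)) :
  multihomog f -> vanishes_on_U f -> eval_rows f (N *m g) = 0.
Proof.
move=> hf Uf; apply: vanish_restrict_factor.
apply: mpoly_eq0_dense (cone_generic_neq0 k) _ => v.
rewrite restrict_factorE cone_generic_map => genN.
have [s [u [Hfree HN]]] := dual_on_conic genN.
apply: (@vanish_dual k 4 2 _ 4 f s u) => //.
rewrite -[RHS]HN; congr (_ *m _).
by apply/matrixP => i j; rewrite !mxE /= mevalXU.
Qed.

(** * Degenerate configurations *)
Lemma increasing_enum n (S : {set 'I_n}) m (Sm : #|S| = m) :
  exists2 s : 'I_m -> 'I_n, {homo s : i j / (i < j)%N} &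
    forall x, x \in S -> exists i, x = s i.
Proof.
subst m; exists enum_val => [i j ij|x xS]; last first.
  by exists (enum_rank_in xS x); rewrite enum_rankK_in.
have x0 : 'I_n by exact: enum_val i.
rewrite !(enum_val_nth x0).
rewrite -!(nth_map x0 0%N val) -?cardE //.
apply: (sorted_ltn_nth ltn_trans) ij; rewrite ?inE ?size_map -?cardE //.
have : sorted ltn [seq val x | x <- enum 'I_n] by rewrite val_enum_ord iota_ltn_sorted.
apply: (subseq_sorted ltn_trans).
by apply: map_subseq; rewrite enumT; apply: filter_subseq.
Qed.

(** If the rank were [d+1], the rows of an invertible square block, taken in
increasing order, would give a nonzero minor. *)
Lemma Y_locus_factor (k : closedFieldType) d n (p : config k d n) : Y_locus k d n p ->
  exists (N : 'M[k]_(n, d)) (g : 'M[k]_(d, d.+1)), \matrix_i hcoord (p i) = N *m g.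
Proof.
move=> Yp; set M := \matrix_i _.
have rM : (\rank M <= d)%N.
  rewrite leqNgt; apply/negP => rd.
  have fullM : row_full M by rewrite /row_full eqn_leq rank_leq_col.
  pose h := fullrankfun fullM.
  have cardS : #|[set h i | i : 'I_d.+1]| = d.+1.
    by rewrite card_imset ?card_ord //; apply: fullrankfun_inj.
  have [s s_incr sS] := increasing_enum cardS.
  have /eqP := Yp s s_incr; apply/negP; rewrite -unitfE -unitmxE.
  have -> : colsub s (coord_mx p) = (rowsub s M)^T.
    by apply/matrixP => i j; rewrite !mxE.
  rewrite unitmx_tr -row_full_unit -sub1mx.
  have /fin_all_exists[r hE] i : exists j, h i = s j by apply/sS/imset_f.
  have h1 : (1%:M <= rowsub h M)%MS by rewrite sub1mx fullrowsub_full.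
  apply: submx_trans h1 _.
  have -> : rowsub h M = rowsub r (rowsub s M).
    by apply/matrixP => i j; rewrite !mxE hE.
  exact: rowsub_sub.
exists (col_ebase M *m pid_mx (\rank M)), (pid_mx (\rank M) *m row_ebase M).
rewrite -[LHS]mulmx_ebase -!mulmxA; congr (_ *m _); rewrite mulmxA mul_pid_mx.
by rewrite minnn (minn_idPr rM).
Qed.

Lemma Y_sub_V (k : closedFieldType) d n :
    (forall (f : coord_ring k d n) (N : 'M[k]_(n, d)) (g : 'M[k]_(d, d.+1)),
       multihomog f -> vanishes_on_U f -> eval_rows f (N *m g) = 0) ->
  forall p, Y_locus k d n p -> V_locus k d n p.
Proof.
move=> vanish p /Y_locus_factor[N [g pE]].
by apply/V_locusP => f hf Uf; rewrite /vanishes_at pE vanish.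
Qed.

Local Close Scope ring_scope.

Theorem proposition4p25 (k : closedFieldType) (d n : nat)
    (hd : 3 <= d) (hn : d + 4 <= n) :
  (forall p : config k d n, Y_locus k d n p -> V_locus k d n p) <->
  (d, n) \in [:: (3, 7); (3, 8); (4, 8)].
Proof.
rewrite !inE !xpair_eqE; split=> [YV|].
  apply: contraPT YV => small.
  have n3 : (2 < n)%N by lia.
  have dn : (d + 2 <= n)%N by lia.
  have d0 : (0 < d)%N by lia.
  have [|p Yp nVp] := @Y_not_sub_V k d n n3 dn d0.
    by rewrite card_param card_obs; nia.
  by move=> /(_ p Yp).
case/or3P => /andP[/eqP -> /eqP ->]; apply: Y_sub_V => f N g hf Uf.
- exact: vanish_rank3.
- exact: vanish_rank3.
- exact: vanish_rank4.
Qed.
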